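(* Let $(K_{E_\omega},\subseteq)$ be the class $\circledast_{n}K_{E_n}$ in the language $\mathcal{L}_{E_\omega}$. Let $(K_2,\leq_2)$ be any $1$-local smooth class with fAP in a countable relational language $\mathcal{L}_2$ (disjoint from $\mathcal{L}_{E_\omega}$). Then the merge $K_0:=K_{E_\omega}\circledast K_2$ in the language $\mathcal{L}_0:=\mathcal{L}_{E_\omega}\cup\mathcal{L}_2$ has $\leq_*$-EPPA.
   Context: All languages are countable and relational. Smooth class. A pair $(K,\leq)$ is a smooth class in the language $\mathcal{L}$ if $K$ is a class of finite $\mathcal{L}$-structures closed under isomorphism and $\leq$ is a binary relation on $K$ such that: (1) $\leq$ is transitive and $A\leq B$ implies $A\subseteq B$ (substructure); (2) for every $B\in K$ and every enumeration $\overline{b}=(b_1,\dots,b_n)$ of $B$ there is a (possibly infinite) set $\Phi_{\overline{b}}(\overline{x})$, $|\overline{x}|=n$, of universal $\mathcal{L}$-formulas containing the atomic diagram of $B$ (w.r.t. $\overline{b}$) such that for all $C\in K$ with $B\subseteq C$: $B\leq C\Leftrightarrow C\models\Phi_{\overline{b}}(\overline{b})$; (3) if $f:A\to B$ is an isomorphism of members of $K$ and $\overline{a}$ enumerates $A$, then $\Phi_{\overline{a}}=\Phi_{f(\overline{a})}$; (4) $\emptyset\in K$ and $\emptyset\leq A$ for all $A\in K$. fAP (free amalgamation). For $A,B,C\in K$ with $A\subseteq B,C$ (and $B\cap C=A$), $C*_AB$ is the structure with universe $B\cup C$ whose relations are exactly those of $B$ and those of $C$. $(K,\leq)$ has fAP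 if whenever $A\leq B$ and $A\leq C$, then $C*_AB\in K$ and $B,C\leq C*_AB$. Smooth intersections. For all $A,B,C\in K$ (substructures of a common structure), $A\leq B$ implies $A\cap C\leq B\cap C$. 1-local. $(K,\leq)$ is $1$-local if $K$ is closed under substructure, $(K,\leq)$ has smooth intersections, and for all $A,C\subseteq B$ in $K$: $A\leq B$ and $C\leq B$ imply $A\cup C\leq B$. Merge. For smooth classes $(K_i,\leq_i)$ in pairwise disjoint languages $\mathcal{L}_i$, $i\in I$, the merge $\circledast_{i\in I}K_i$ is the smooth class $(K^*,\leq_* )$ in $\bigcup_i\mathcal{L}_i$, where $K^*$ is the class of finite structures $A$ with $A|_{\mathcal{L}_i}\in K_i$ for all $i$, and $A\leq_*B$ iff $A|_{\mathcal{L}_i}\leq_iB|_{\mathcal{L}_i}$ for all $i$. In particular, in $K_0$: $A\leq_*B$ iff $A|_{\mathcal{L}_2}\leq_2B|_{\mathcal{L}_2}$ and $A|_{\mathcal{L}_{E_\omega}}\subseteq B|_{\mathcal{L}_{E_\omega}}$. $n$-tuple equivalence relations. For $n\geq1$, a $2n$-ary relation $E_n$ is an $n$-tuple equivalence relation if it never holds when one of its two $n$-tuples has a repeated entry, it is an equivalence relation on the set of $n$-tuples with pairwise distinct entries, and whenever $E_n(\overline{a},\overline{b})$ holds then $E_n(\overline{a},\overline{b}_\sigma)$ holds for every permutation $\overline{b}_\sigma$ of $\overline{b}$. $(K_{E_n},\subseteq)$ is the class of all finite structures with an $n$-tuple equivalence relation in the language $\{E_n\}$; $\mathcal{L}_{E_\omega}=\{E_n:n\geq1\}$;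 and $K_{E_\omega}=\circledast_nK_{E_n}$, whose relation is $\subseteq$. $\leq$-EPPA. $(K,\leq)$ has $\leq$-EPPA if for any $A\in K$ and any partial automorphisms $f_1,\dots,f_n$ of $A$ (isomorphisms between substructures of $A$) with $\mathrm{dom}(f_i)\leq A$ and $\mathrm{range}(f_i)\leq A$ for each $i$, there exist $B\in K$ with $A\leq B$ and automorphisms $g_1,\dots,g_n$ of $B$ with $f_i\subseteq g_i$ for each $i$. *)

(* Defs.v *)
From mathcomp Require Import all_boot all_fingroup finmap.
Set Implicit Arguments.
Unset Strict Implicit.
Unset Printing Implicit Defensive.
Local Open Scope fset_scope.

Record language := Language { sym : countType; ar : sym -> nat }.

(* Finite structures have as universe a finite subset of an ambient type [U],
   so that inclusions, intersections and unions of universes are literal.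
   [U] plays the role of the set-theoretic universe; since classes of
   structures are closed under isomorphism, any infinite [U] will do. *)
Record fstruct (U : choiceType) (L : language) := FStruct {
  dom : {fset U};
  holds : forall s : sym L, (ar s).-tuple U -> bool;
  holds_dom : forall (s : sym L) (t : (ar s).-tuple U),
    holds t -> all (mem dom) t }.

Section Structures.
Variables (U : choiceType) (L : language).
Implicit Types A B C : fstruct U L.

Definition substruct A B : Prop :=
  dom A `<=` dom B /\
  forall (s : sym L) (t : (ar s).-tuple U),
    all (mem (dom A)) t -> holds A t = holds B t.

(* Only the values of [f] on [dom A] matter. *)
Definition iso (f : U -> U) A B : Prop :=
  [/\ {in dom A &, injective f},
      [fset f x | x in dom A] = dom B &
      forall (s : sym L) (t : (ar s).-tuple U),
        all (mem (dom A)) t -> holds A t = holds B (map_tuple f t)].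

Fact empty_holds_dom (s : sym L) (t : (ar s).-tuple U) :
  false -> all (mem (fset0 : {fset U})) t.
Proof. by []. Qed.

Definition empty_struct : fstruct U L :=
  @FStruct U L fset0 (fun _ _ => false) empty_holds_dom.

Fact restrict_holds_dom A (S : {fset U}) (s : sym L) (t : (ar s).-tuple U) :
  all (mem S) t && holds A t -> all (mem (dom A `&` S)) t.
Proof.
case/andP=> /allP tS /holds_dom/allP tA; apply/allP=> x xt.
by rewrite inE; apply/fsetIP; split; [apply: tA | apply: tS].
Qed.

Definition restrict_struct A (S : {fset U}) : fstruct U L :=
  FStruct (@restrict_holds_dom A S).

Fact amalgam_holds_dom B C (s : sym L) (t : (ar s).-tuple U) :
  holds B t || holds C t -> all (mem (dom B `|` dom C)) t.
Proof.
by case/orP=> /holds_dom/allP tD; apply/allP=> x /tD xD;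
  rewrite inE; apply/fsetUP; [left | right].
Qed.

(* The free amalgam of [B] and [C] over [A], where [dom B `&` dom C = dom A]. *)
Definition free_amalgam B C : fstruct U L :=
  FStruct (@amalgam_holds_dom B C).

End Structures.

Inductive qf (L : language) (V : Type) : Type :=
| QFalse
| QEq of V & V
| QRel (s : sym L) of (ar s).-tuple V
| QNot of qf L V
| QAnd of qf L V & qf L V
| QOr of qf L V & qf L V.

(* A universal formula with free variables x_0, .., x_(n-1) (left summand) and
   universally quantified y_0, .., y_(uvars - 1) (right summand). *)
Record uformula (L : language) (n : nat) :=
  UFormula { uvars : nat; umatrix : qf L ('I_n + 'I_uvars) }.

Section Satisfaction.
Variables (U : choiceType) (L : language).

Fixpoint qf_sat (A : fstruct U L) (V : Type) (v : V -> U) (phi : qf L V) :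
    bool :=
  match phi with
  | QFalse => false
  | QEq x y => v x == v y
  | QRel s t => holds A (map_tuple v t)
  | QNot p => ~~ qf_sat A v p
  | QAnd p q => qf_sat A v p && qf_sat A v q
  | QOr p q => qf_sat A v p || qf_sat A v q
  end.

Definition valuation n m (b : n.-tuple U) (y : m.-tuple U)
    (x : 'I_n + 'I_m) : U :=
  match x with inl i => tnth b i | inr j => tnth y j end.

Definition usat (A : fstruct U L) n (b : n.-tuple U) (phi : uformula L n) :
    Prop :=
  forall y : (uvars phi).-tuple U, all (mem (dom A)) y ->
    qf_sat A (valuation b y) (umatrix phi).

Definition is_atom V (phi : qf L V) : Prop :=
  match phi with QEq _ _ | QRel _ _ => True | _ => False end.

Definition is_literal V (phi : qf L V) : Prop :=
  match phi with QNot p => is_atom p | _ => is_atom phi end.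

Definition atomic_diagram (B : fstruct U L) n (b : n.-tuple U)
    (phi : uformula L n) : Prop :=
  [/\ uvars phi = 0, is_literal (umatrix phi) & usat B b phi].

Definition enumerates n (b : n.-tuple U) (B : fstruct U L) : Prop :=
  uniq b /\ b =i dom B.

End Satisfaction.

Record fclass (U : choiceType) (L : language) := FClass {
  mem_class : fstruct U L -> Prop;
  le_class : fstruct U L -> fstruct U L -> Prop }.

Section Classes.
Variables (U : choiceType) (L : language) (K : fclass U L).
Implicit Types A B C M : fstruct U L.

Local Notation "A '\inK'" := (mem_class K A) (at level 70).
Local Notation "A <=K B" := (le_class K A B) (at level 70).

Definition smooth_axioms : Prop :=
  exists Phi : forall (B : fstruct U L) (n : nat),
      n.-tuple U -> uformula L n -> Prop,
    (forall B n (b : n.-tuple U), B \inK -> enumerates b B ->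
       (forall phi, atomic_diagram B b phi -> Phi B n b phi) /\
       (forall C, C \inK -> substruct B C ->
          (B <=K C <-> forall phi, Phi B n b phi -> usat C b phi))) /\
    (forall (f : U -> U) A B n (a : n.-tuple U), A \inK -> B \inK ->
       iso f A B -> enumerates a A ->
       forall phi, Phi A n a phi <-> Phi B n (map_tuple f a) phi).

Record smooth : Prop := Smooth {
  smooth_iso : forall (f : U -> U) A B, A \inK -> iso f A B -> B \inK;
  smooth_mem : forall A B, A <=K B -> A \inK /\ B \inK;
  smooth_trans : forall A B C, A <=K B -> B <=K C -> A <=K C;
  smooth_sub : forall A B, A <=K B -> substruct A B;
  smooth_formulas : smooth_axioms;
  smooth_empty : empty_struct U L \inK;
  smooth_empty_le : forall A, A \inK -> empty_struct U L <=K A }.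

Definition fAP : Prop :=
  forall A B C, A <=K B -> A <=K C -> dom B `&` dom C = dom A ->
    [/\ free_amalgam B C \inK, B <=K free_amalgam B C &
        C <=K free_amalgam B C].

Definition smooth_intersections : Prop :=
  forall M A B C, A \inK -> B \inK -> C \inK ->
    substruct A M -> substruct B M -> substruct C M ->
    A <=K B -> restrict_struct A (dom C) <=K restrict_struct B (dom C).

Record one_local : Prop := OneLocal {
  one_local_sub : forall A B, B \inK -> substruct A B -> A \inK;
  one_local_inter : smooth_intersections;
  one_local_union : forall A B C, A \inK -> B \inK -> C \inK ->
    substruct A B -> substruct C B -> A <=K B -> C <=K B ->
    restrict_struct B (dom A `|` dom C) <=K B }.

Definition partial_aut (f : U -> U) A P Q : Prop :=
  [/\ substruct P A, substruct Q A & iso f P Q].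

Definition EPPA : Prop :=
  forall A (n : nat) (f : 'I_n -> U -> U) (P Q : 'I_n -> fstruct U L),
    A \inK ->
    (forall i, [/\ partial_aut (f i) A (P i) (Q i), P i <=K A & Q i <=K A]) ->
    exists (B : fstruct U L) (g : 'I_n -> U -> U),
      [/\ B \inK, A <=K B &
          forall i, iso (g i) B B /\ {in dom (P i), g i =1 f i}].

End Classes.

(* Disjoint unions of languages: the symbols of the i-th language are tagged
   with i, so the languages being merged are disjoint by construction. *)
Definition merge_lang (I : countType) (L : I -> language) : language :=
  @Language {i : I & sym (L i)} (fun s => ar (tagged s)).

Section Merge.
Variables (U : choiceType) (I : countType) (L : I -> language).

Fact reduct_holds_dom (A : fstruct U (merge_lang L)) (i : I) (s : sym (L i))
    (t : (ar s).-tuple U) :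
  @holds _ _ A (existT (fun i => sym (L i)) i s) t -> all (mem (dom A)) t.
Proof. exact: holds_dom. Qed.

Definition reduct (i : I) (A : fstruct U (merge_lang L)) : fstruct U (L i) :=
  FStruct (@reduct_holds_dom A i).

Definition merge_class (K : forall i, fclass U (L i)) : fclass U (merge_lang L) :=
  FClass (fun A => forall i, mem_class (K i) (reduct i A))
         (fun A B => forall i, le_class (K i) (reduct i A) (reduct i B)).

End Merge.

Definition lang2 (L1 L2 : language) (b : bool) : language :=
  if b then L1 else L2.

Definition class2 (U : choiceType) (L1 L2 : language)
    (K1 : fclass U L1) (K2 : fclass U L2) (b : bool) :
    fclass U (lang2 L1 L2 b) :=
  if b return fclass U (lang2 L1 L2 b) then K1 else K2.

Definition merge_pair (U : choiceType) (L1 L2 : language)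
    (K1 : fclass U L1) (K2 : fclass U L2) :
    fclass U (merge_lang (lang2 L1 L2)) :=
  merge_class (class2 K1 K2).

Definition lang_E (n : nat) : language := @Language unit (fun _ => (n + n)%N).

Section TupleEquivalence.
Variables (U : choiceType) (n : nat).
Implicit Types (a b c : n.-tuple U).

Definition Erel (A : fstruct U (lang_E n)) (a b : n.-tuple U) : bool :=
  @holds U (lang_E n) A tt (cat_tuple a b).

Definition permute_tuple (s : 'S_n) (b : n.-tuple U) : n.-tuple U :=
  [tuple tnth b (s i) | i < n].

Record tuple_equiv (A : fstruct U (lang_E n)) : Prop := TupleEquiv {
  teq_uniq : forall a b, Erel A a b -> uniq a /\ uniq b;
  teq_refl : forall a, all (mem (dom A)) a -> uniq a -> Erel A a a;
  teq_sym : forall a b, Erel A a b -> Erel A b a;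
  teq_trans : forall a b c, Erel A a b -> Erel A b c -> Erel A a c;
  teq_perm : forall a b (s : 'S_n), Erel A a b -> Erel A a (permute_tuple s b) }.

Definition class_E : fclass U (lang_E n) :=
  FClass tuple_equiv
         (fun A B => [/\ tuple_equiv A, tuple_equiv B & substruct A B]).

End TupleEquivalence.

(* The tuple length ranges over n >= 1, hence the successors. *)
Definition lang_Eomega : language := merge_lang (fun n : nat => lang_E n.+1).

Definition class_Eomega (U : choiceType) : fclass U lang_Eomega :=
  merge_class (fun n : nat => class_E U n.+1).

(* Main.v *)
From mathcomp Require Import all_boot all_fingroup finmap boolp.
Require Import Defs.
Set Implicit Arguments.
Unset Strict Implicit.
Unset Printing Implicit Defensive.

(** Since [E_n] is invariant under permuting a tuple, it is an equivalence
    relation on sets of [n] points; give every nonempty set of points of [A]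
    its class as a colour.  A partial automorphism [f] of [A] need not preserve
    colours, but it permutes them.  So [f] is extended to a permutation of the
    points together with a permutation of the colours, and the theorem becomes
    an extension problem for one finite group [gT] acting on points and
    colours: [good Z s] says that [s] acts on [Z] as a partial isomorphism of
    [A], twisted by its action on the colours.  By 1-locality the strong
    subsets of [A] are closed under unions and intersections, so each point [x]
    has a least strong set [cl x] around it, and a set is strong as soon as it
    contains [cl x] for each of its points [x].

    The combinatorial core, [exists_conformal_extension], provides a finite set
    [T] containing a copy [i] of [X] (the points of [A]), and a group [G] of
    permutations of [T] lying over [gT], such that every good partial map of
    [X] extends to an element of [G]; an element of [G] that sends some points
    of the copy back into the copy is good there, on a set closed under [cl];
    and a closed subset of [T] any two points of which lie in a common
    [G]-translate of the copy lies in a single translate.  It is built as a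
    tower of three extensions:
    - [exists_extension]: parity valuations record, for each subset [Z] of [X],
      which elements of [gT] are good on it; this is the classical argument for
      EPPA of relational structures;
    - [vaut_conformal]: a set [u] contained in no translate of the copy is ruled
      out by requiring distinct values at its points when fewer than [#|u|]
      values are available, as in the theorem of Hodkinson and Otto;
    - [caut_conformal]: each point is replaced by the point together with a
      copy of its closure, so that closures become well defined.

    Gluing the translates of [A] along [T] gives the structure [B].  A closed
    subset of [B] either lies in one translate, and is then isomorphic to a
    strong substructure of [A], or has two points in no common translate, and
    is then a free amalgam of two smaller closed subsets; by induction
    ([glue_closed]) free amalgamation and 1-locality put [B] in [K2] with all
    closed subsets strong.  The colours move along with [G], so that equality
    of colours defines the relations [E_n] on [B]; they restrict correctly to
    [A] because the elements of [G] are good wherever they map the copy to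
    itself ([Eglue_sub]). *)

(** * Extending partial injections to permutations *)

(** By induction on the list: having matched the tail, a transposition corrects
    the image of the new point without disturbing the others.  The set [V]
    keeps the permutation inside the set of allowed values. *)
Lemma extend_to_perm_seq (I : eqType) (T : finType) (V : {set T}) (r : seq I)
    (h k : I -> T) :
    {in r &, forall x y, (h x == h y) = (k x == k y)} ->
    {in r, forall x, h x \in V /\ k x \in V} ->
  exists s : {perm T},
    {in r, forall x, s (h x) = k x} /\ forall v, (s v \in V) = (v \in V).
Proof.
elim: r => [|x r IH] hk inV; first by exists 1%g; split=> // v; rewrite perm1.
have [s [sE sV]] : exists s : {perm T},
    {in r, forall x, s (h x) = k x} /\ forall v, (s v \in V) = (v \in V).
  apply: IH => [y z yr zr|y yr]; first by apply: hk; rewrite inE ?yr ?zr orbT.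
  by apply: inV; rewrite inE yr orbT.
have xr : x \in x :: r by rewrite inE eqxx.
case: (boolP (has (fun y => h y == h x) r)) => [/hasP[y yr hyx]|/hasPn nhx].
  exists s; split=> // z; rewrite inE => /orP[/eqP->|]; last exact: sE.
  have yr' : y \in x :: r by rewrite inE yr orbT.
  by move: (hyx); rewrite hk // => /eqP <-; rewrite -(eqP hyx) sE.
exists (s * tperm (s (h x)) (k x))%g; split=> [z|v]; last first.
  have [hxV kxV] := inV x xr.
  by rewrite permM -[RHS]sV; case: tpermP => // ->; rewrite ?kxV ?sV ?hxV.
rewrite inE permM => /orP[/eqP->|zr]; first by rewrite tpermL.
have zr' : z \in x :: r by rewrite inE zr orbT.
have hzx := nhx z zr.
rewrite (sE z zr) tpermD // eq_sym; last by rewrite -hk.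
by rewrite -(sE z zr) (inj_eq perm_inj).
Qed.

Lemma extend_to_perm (I T : finType) (V : {set T}) (Z : {set I}) (h k : I -> T) :
    {in Z &, forall x y, (h x == h y) = (k x == k y)} ->
    {in Z, forall x, h x \in V /\ k x \in V} ->
  exists s : {perm T},
    {in Z, forall x, s (h x) = k x} /\ forall v, (s v \in V) = (v \in V).
Proof.
move=> hk inV; have [||s [sE sV]] := @extend_to_perm_seq _ _ V (enum Z) h k.
- by move=> x y; rewrite !mem_enum; apply: hk.
- by move=> x; rewrite mem_enum; apply: inV.
by exists s; split=> // x xZ; apply: sE; rewrite mem_enum.
Qed.

Lemma imset_permK (T : finType) (a : {perm T}) (u : {set T}) : a^-1%g @: (a @: u) = u.
Proof.
by rewrite -imset_comp (eq_imset (g := id)) ?imset_id // => x /=; rewrite permK.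
Qed.

Lemma imset_permKV (T : finType) (a : {perm T}) (u : {set T}) : a @: (a^-1%g @: u) = u.
Proof. by have := imset_permK a^-1%g u; rewrite invgK. Qed.

(** * First extension: parity valuations *)

Section Extensions.
Local Open Scope group_scope.
Variables (X : finType) (gT : finGroupType) (to : {action gT &-> X}).
Variable good : {set X} -> gT -> bool.
Implicit Types (Z V : {set X}) (s t : gT) (x y : X).

(** An abstraction of the partial isomorphisms of a structure on [X]: [good Z s]
    stands for [s] restricting to a partial isomorphism between strong subsets,
    with domain [Z].  In particular [good Z 1] says that [Z] is strong. *)
Record partial_symmetries : Prop := PartialSymmetries {
  psym0 : forall s, good set0 s;
  psymV : forall Z s, good Z s -> good (to^* Z s) s^-1;
  psymM : forall Z s t, good Z s -> good (to^* Z s) t -> good Z (s * t);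
  psymS : forall V Z s, good V s -> Z \subset V -> good Z 1 -> good Z s }.

(** [T] carries a group [G] of permutations, each element [a] of which lies over
    some [s : gT]; [ext_act] makes this lift compatible with the copy [i], and
    [ext_good] reflects agreement on a strong set into goodness. *)
Record extension (T : finType) (i : X -> T) (G : {perm T} -> gT -> Prop) :
    Prop := Extension {
  extM : forall a b s t, G a s -> G b t -> G (a * b) (s * t);
  extV : forall a s, G a s -> G a^-1 s^-1;
  ext_act : forall a s x y, G a s -> a (i x) = i y -> y = to x s;
  ext_good : forall a s Z, G a s -> good Z 1 ->
    {in Z, forall x, a (i x) = i (to x s)} -> good Z s;
  ext_extend : forall Z s, good Z s ->
    exists2 a, G a s & {in Z, forall x, a (i x) = i (to x s)} }.

Hypothesis good_sym : partial_symmetries.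

Section ExtensionTheory.
Variables (T : finType) (i : X -> T) (G : {perm T} -> gT -> Prop).
Hypothesis extT : extension i G.

Lemma ext1 : G 1 1.
Proof.
have [a Ga _] := ext_extend extT (psym0 good_sym 1).
by have := extM extT Ga (extV extT Ga); rewrite !mulgV.
Qed.

Lemma ext_inj : injective i.
Proof.
move=> x y ixy; have := ext_act (x := x) (y := y) extT ext1.
by rewrite perm1 act1 => /(_ ixy).
Qed.
End ExtensionTheory.

Lemma psym1 Z s : good Z s -> good Z 1.
Proof.
move=> gZ; rewrite -(mulgV s); exact: (psymM good_sym gZ (psymV good_sym gZ)).
Qed.

Lemma psym_im1 Z s : good Z s -> good (to^* Z s) 1.
Proof. by move/(psymV good_sym)/psym1. Qed.

(** A mark [(Z, t)] stands for the image of a pattern on [to^* Z t^-1] under [t].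
    A point of the extension is a point [x] of [X] with a bit for each mark, and
    lifts of the points of [Z] satisfy the mark [(Z, t)] when the sum of their
    bits is odd.  The copy of [X] satisfies the marks with [t] good on
    [to^* Z t^-1] and [Z] nonempty: one chosen point of [Z] carries the bit.  Automorphisms move the points and
    the marks by [s] and flip bits without changing any of the sums; a partial
    map has enough freedom to do this, as points outside its domain can
    compensate for the flips inside. *)
Section Parity.
Definition pindex := ({set X} * gT)%type.
Definition move_pindex (u : pindex) s : pindex := (to^* u.1 s, u.2 * s).
Definition ppoint := (X * {ffun pindex -> bool})%type.
Definition plabel (u : pindex) := good (to^* u.1 u.2^-1) u.2.
Definition parity_embed x : ppoint :=
  (x, [ffun u : pindex => (Some x == [pick y in u.1]) && plabel u]).
Definition parity_aut (a : {perm ppoint}) s :=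
  exists2 e : X -> pindex -> bool,
    forall u : pindex, \big[addb/false]_(x in u.1) e x u = false &
    forall y : ppoint, (a y).1 = to y.1 s /\
      forall u : pindex, (a y).2 (move_pindex u s) = y.2 u (+) e y.1 u.

Lemma move_pindexK s : cancel (move_pindex^~ s) (move_pindex^~ s^-1).
Proof. by case=> Z t; rewrite /move_pindex /= actK mulgK. Qed.

Lemma move_pindexKV s : cancel (move_pindex^~ s^-1) (move_pindex^~ s).
Proof. by case=> Z t; rewrite /move_pindex /= actKV mulgKV. Qed.

Lemma parity_move s (F : X -> bool) Z :
  \big[addb/false]_(x in to^* Z s) F x = \big[addb/false]_(x in Z) F (to x s).
Proof. by rewrite setactE big_imset //=; apply: in2W (act_inj to s). Qed.

Lemma parity_embed_sum (u : pindex) :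
  \big[addb/false]_(x in u.1) (parity_embed x).2 u = (u.1 != set0) && plabel u.
Proof.
case: (set_0Vmem u.1) => [->|[z zu]].
  by rewrite eqxx big_set0.
have u_neq0 : u.1 != set0 by apply/set0Pn; exists z.
rewrite u_neq0; case E: [pick y in u.1] => [y|]; last first.
  by move: E; case: pickP => // /(_ z); rewrite zu.
have yu : y \in u.1 by move: E; case: pickP => // w wu [<-].
rewrite (bigD1 y) //= ffunE E eqxx big1 ?addbF // => x /andP[_ xy].
by rewrite ffunE E (inj_eq Some_inj) (negPf xy).
Qed.

(** Compose with the good map, or with its inverse. *)
Lemma label_move P s Z t : good P s -> Z \subset P ->
  plabel (move_pindex (Z, t) s) = plabel (Z, t).
Proof.
move=> gP ZP; rewrite /plabel /= invMg actM actK.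
apply/idP/idP => gZ.
  have := psym_im1 gZ; rewrite actM actKV => gsZ.
  have : good (to^* Z s) s^-1.
    by apply: (psymS good_sym (psymV good_sym gP)) gsZ; rewrite !setactE imsetS.
  move=> gsZV; have := @psymM good_sym _ _ s^-1 gZ.
  by rewrite actM actKV mulgK; apply.
have := psym_im1 gZ; rewrite actKV => gZ1.
apply: (psymM good_sym gZ); rewrite actKV; exact: (psymS good_sym gP ZP gZ1).
Qed.

Lemma exists_extension : exists (T : finType) (i : X -> T) (G : {perm T} -> gT -> Prop),
  extension i G.
Proof.
exists _, parity_embed, parity_aut; split.
- move=> a b s t [e e0 eE] [f f0 fE].
  exists (fun x u => e x u (+) f (to x s) (move_pindex u s)) => [u|y].
    rewrite big_split /= e0 /=.
    by have := f0 (move_pindex u s); rewrite parity_move.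
  have [ay ayE] := eE y; have [by_ byE] := fE (a y).
  rewrite permM by_ ay actM; split=> // u.
  have -> : move_pindex u (s * t) = move_pindex (move_pindex u s) t.
    by rewrite /move_pindex /= actM mulgA.
  by rewrite byE ay ayE addbA.
- move=> a s [e e0 eE].
  exists (fun x u => e (to x s^-1) (move_pindex u s^-1)) => [u|y].
    by have := e0 (move_pindex u s^-1); rewrite parity_move.
  have [ay ayE] := eE (a^-1 y); rewrite permKV in ay ayE; split.
    by rewrite ay actK.
  move=> u; have := ayE (move_pindex u s^-1); rewrite move_pindexKV => ->.
  by rewrite ay actK addbK.
- by move=> a s x y [e _ /(_ (parity_embed x))[/= ax _]] /(congr1 fst) /=; rewrite ax.
- move=> a s Z [e e0 eE] gZ aZ.
  case: (set_0Vmem Z) => [->|[z zZ]]; first exact: psym0.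
  have Zn0 : Z != set0 by apply/set0Pn; exists z.
  have sumE : \big[addb/false]_(x in to^* Z s) (parity_embed x).2 (move_pindex (Z, 1) s) =
      \big[addb/false]_(x in Z) ((parity_embed x).2 (Z, 1) (+) e x (Z, 1)).
    rewrite parity_move; apply: eq_bigr => x xZ.
    by rewrite -aZ //; have [_ ->] := eE (parity_embed x).
  (* The copy of Z satisfies the mark (Z, 1), hence its image satisfies (sZ, s). *)
  move: sumE; rewrite (parity_embed_sum (move_pindex (Z, 1) s)) => /esym.
  rewrite big_split /= (e0 (Z, 1)) (parity_embed_sum (Z, 1)) /= Zn0 /plabel /=.
  rewrite invg1 act1 gZ mul1g actK /=.
  by case: (good Z s) => //; rewrite andbF.
move=> P s gP.
(* The flips d are forced on the domain P; one chosen point of a set that is not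
   contained in P absorbs their sum. *)
pose d x u := (parity_embed (to x s)).2 (move_pindex u s) (+) (parity_embed x).2 u.
pose e x (u : pindex) :=
  if x \in P then d x u
  else (Some x == [pick y in u.1 :\: P]) && \big[addb/false]_(y in u.1 | y \in P) d y u.
pose a0 (y : ppoint) : ppoint :=
  (to y.1 s, [ffun u => y.2 (move_pindex u s^-1) (+) e y.1 (move_pindex u s^-1)]).
have a0_inj : injective a0.
  move=> [x c] [x' c'] [/act_inj <- /ffunP cc']; congr (_, _).
  apply/ffunP=> u; have := cc' (move_pindex u s); rewrite !ffunE move_pindexK.
  exact: addIb.
exists (perm a0_inj); last first.
  move=> x xP; rewrite permE /a0 /=; congr (_, _); apply/ffunP=> u.
  rewrite [LHS]ffunE /e xP /d move_pindexKV /=.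
  by rewrite addbC -addbA addbb addbF.
exists e => [u|y]; last first.
  by rewrite permE; split=> // u; rewrite ffunE move_pindexK.
rewrite (bigID (mem P)) /=.
rewrite (eq_bigr (d^~ u)); last by move=> x /andP[_ xP]; rewrite /e xP.
set S := \big[_/_]_(x | (x \in u.1) && (x \in P)) _.
case: (set_0Vmem (u.1 :\: P)) => [uP|[z zu]].
  have sub : u.1 \subset P by rewrite -setD_eq0 uP.
  rewrite [X in _ (+) X]big_pred0 => [|x]; last first.
    by apply/andP=> -[xu /negP[]]; apply: (subsetP sub).
  rewrite addbF /S (eq_bigl (mem u.1)) => [|x]; last first.
    by rewrite inE; case xu: (x \in u.1); rewrite //= (subsetP sub).
  rewrite big_split /=.
  rewrite -(parity_move s (fun x => (parity_embed x).2 (move_pindex u s))).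
  rewrite (parity_embed_sum (move_pindex u s)) parity_embed_sum.
  case: u sub {uP S} => Z t /= sub; rewrite (label_move _ gP sub).
  by rewrite setactE imset_eq0 addbb.
case E: [pick y in u.1 :\: P] => [y|]; last first.
  by move: E; case: pickP => // /(_ z); rewrite zu.
have yu : y \in u.1 :\: P by move: E; case: pickP => // w wu [<-].
have [yu1 yP] : y \in u.1 /\ y \notin P by move: yu; rewrite inE => /andP[].
rewrite (bigD1 y) ?yu1 ?yP //= [X in _ (+) (_ (+) X)]big1 => [|x].
  by rewrite /e (negPf yP) E eqxx addbF addbb.
move=> /andP[/andP[_ xP] xy].
by rewrite /e (negPf xP) E (inj_eq Some_inj) (negPf xy).
Qed.

End Parity.
End Extensions.

(** * Second extension: conformality *)

Section Copies.
Variables (X gT T : finType) (i : X -> T) (G : {perm T} -> gT -> Prop).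

Definition in_copy (D : {set T}) : Prop :=
  exists a s, G a s /\ {in D, forall d, exists x, d = a (i x)}.

Definition pairwise_in_copies (D : {set T}) : Prop :=
  {in D &, forall d d', in_copy [set d; d']}.

End Copies.

(** Call [u] large when no translate of the copy contains it.  A point of the new
    extension is a point of [T] with a slot for each large set around it, where
    [u] has only [#|u|.-1] slots.  Generic points use distinct slots in all the
    large sets that they share, hence pairwise generic points cannot project
    onto a large set.  The copy of [X] is generic, since it meets a large set
    [u] in fewer than [#|u|] points. *)

Section Conformal.
Local Open Scope group_scope.
Variables (X : finType) (gT : finGroupType) (to : {action gT &-> X}).
Variable good : {set X} -> gT -> bool.
Hypothesis good_sym : partial_symmetries to good.
Variables (T : finType) (i : X -> T) (G : {perm T} -> gT -> Prop).
Hypothesis extT : extension to good i G.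
Implicit Types (u : {set T}).

(** At a set that is not large, or does not contain the base point, [valid] pins
    the value to [ord0], so that such sets need no care when a partial map is
    lifted. *)
Definition slot := 'I_#|T|.+1.
Definition vpoint := (T * {ffun {set T} -> slot})%type.

Definition large u : bool := ~~ `[< in_copy i G u >].
Definition slots u : {set slot} := [set v : slot | v < #|u|.-1].
Definition valid (y : vpoint) : bool :=
  [forall u, if large u && (y.1 \in u) then y.2 u \in slots u else y.2 u == ord0].
Definition generic (y z : vpoint) : bool :=
  (y.1 != z.1) &&
  [forall u, [&& large u, y.1 \in u & z.1 \in u] ==> (y.2 u != z.2 u)].
Definition copy_rank u x := index (i x) (enum (u :&: [set i x | x in X])).
Definition vembed x : vpoint :=
  (i x, [ffun u => if large u && (i x \in u) then inord (copy_rank u x) else ord0]).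
Definition vaut (a2 : {perm vpoint}) s : Prop :=
  exists2 a, G a s & [/\ forall y : vpoint, (a2 y).1 = a y.1,
    forall y, valid (a2 y) = valid y &
    forall y z, generic (a2 y) (a2 z) = generic y z].

Lemma in_slots u v : (v \in slots u) = (v < #|u|.-1).
Proof. by rewrite inE. Qed.

Lemma in_copy_im a s (D : {set T}) : G a s -> in_copy i G D -> in_copy i G (a @: D).
Proof.
move=> Ga [b [t [Gb bD]]]; exists (b * a), (t * s); split; first exact: (extM extT).
move=> d /imsetP[d' /bD[x ->] ->]; exists x; by rewrite permM.
Qed.

Lemma large_im a s u : G a s -> large (a @: u) = large u.
Proof.
move=> Ga; congr (~~ _); apply/asboolP/asboolP; last exact: in_copy_im Ga.
by move/(in_copy_im (extV extT Ga)); rewrite imset_permK.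
Qed.

Lemma copy_rank_lt u x : large u -> i x \in u -> copy_rank u x < #|u|.-1.
Proof.
move=> ularge ixu; have ixuX : i x \in u :&: [set i x | x in X].
  by rewrite inE ixu imset_f.
have : copy_rank u x < #|u :&: [set i x | x in X]|.
  by rewrite cardE index_mem mem_enum.
move/leq_trans; apply; rewrite -ltnS prednK; last by apply/card_gt0P; exists (i x).
apply: proper_card; rewrite properEneq subsetIl andbT; apply: contraNneq ularge => uX.
apply/asboolP; exists 1, 1; split; first exact: (ext1 good_sym extT).
move=> d; rewrite -uX inE => /andP[_ /imsetP[y _ ->]]; exists y; by rewrite perm1.
Qed.

Lemma copy_rank_slot u x : large u -> i x \in u -> copy_rank u x < #|T|.+1.
Proof.
move=> ularge ixu; apply: ltn_trans (copy_rank_lt ularge ixu) _.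
rewrite ltnS; exact: leq_trans (leq_pred _) (max_card u).
Qed.

Lemma copy_rank_inj u x y : i x \in u -> i y \in u ->
  copy_rank u x = copy_rank u y -> x = y.
Proof.
move=> xu yu /(congr1 (nth (i x) (enum (u :&: [set i x | x in X])))).
rewrite !nth_index ?mem_enum ?inE ?xu ?yu ?imset_f //; exact: (ext_inj good_sym extT).
Qed.

Lemma vembed_valid x : valid (vembed x).
Proof.
apply/forallP=> u; rewrite /= ffunE; case E: (_ && _) => //.
have /andP[ularge ixu] := E; rewrite in_slots inordK; [exact: copy_rank_lt | exact: copy_rank_slot].
Qed.

Lemma vembed_generic x y : x != y -> generic (vembed x) (vembed y).
Proof.
move=> xy; rewrite /generic /= (inj_eq (ext_inj good_sym extT)) xy /=.
apply/forallP=> u; apply/implyP=> /and3P[ularge ixu iyu]; rewrite !ffunE ularge ixu iyu /=.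
apply: contra_neq xy => /(congr1 val) /=; rewrite !inordK ?copy_rank_slot //.
exact: copy_rank_inj.
Qed.

(** Genericity is all that the lifted automorphisms have to respect, so any
    generic family of points over a translated part of the copy is itself a
    translate: in each large set the slots can be permuted independently. *)
Lemma lift_copy a s (Z : {set X}) (d : X -> vpoint) : G a s ->
    {in Z, forall x, (d x).1 = a (i x)} -> {in Z, forall x, valid (d x)} ->
    {in Z &, forall x y, x != y -> generic (d x) (d y)} ->
  exists2 b, vaut b s & {in Z, forall x, b (vembed x) = d x}.
Proof.
move=> Ga dE dvalid dgen.
have /fin_all_exists[th thP] u : exists th : {perm slot}, large u ->
    {in [set x in Z | i x \in u], forall x, th ((vembed x).2 u) = (d x).2 (a @: u)} /\
    forall v, (th v \in slots u) = (v \in slots u).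
  case: (boolP (large u)) => ularge; last by exists 1.
  have [||th thP] := @extend_to_perm _ _ (slots u) [set x in Z | i x \in u]
    (fun x => (vembed x).2 u) (fun x => (d x).2 (a @: u)); last by exists th.
    move=> x y; rewrite !inE => /andP[xZ xu] /andP[yZ yu].
    have [->|xy] := eqVneq x y; first by rewrite !eqxx.
    have /andP[_ /forallP/(_ u)] := vembed_generic xy.
    rewrite ularge xu yu /= => /negPf->.
    have /andP[_ /forallP/(_ (a @: u))] := dgen x y xZ yZ xy.
    rewrite (large_im _ Ga) ularge !dE // !mem_imset ?xu ?yu /=; try exact: perm_inj.
    by move/negPf->.
  move=> x; rewrite inE => /andP[xZ xu].
  have /forallP/(_ u) := vembed_valid x; rewrite ularge xu /= => ->; split=> //.
  have /forallP/(_ (a @: u)) := dvalid x xZ.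
  rewrite dE // mem_imset ?xu; last exact: perm_inj.
  rewrite (large_im _ Ga) ularge /= !in_slots card_imset //; exact: perm_inj.
pose upd (b : T) (u : {set T}) v := if large u && (b \in u) then th u v else v.
pose f (y : vpoint) : vpoint :=
  (a y.1, [ffun u : {set T} => upd y.1 (a^-1 @: u) (y.2 (a^-1 @: u))]).
have fE (y : vpoint) u : (f y).2 (a @: u) = upd y.1 u (y.2 u) by rewrite ffunE imset_permK.
have f_inj : injective f.
  move=> [b c] [b' c'] fbc; have [/perm_inj bb' _] := fbc; subst b'; congr (_, _).
  apply/ffunP=> u; have := congr1 (fun y : vpoint => y.2 (a @: u)) fbc; rewrite !fE /upd /=.
  by case: ifP => // _ /perm_inj.
have mem_a x (u : {set T}) : (a x \in a @: u) = (x \in u) by rewrite mem_imset //; exact: perm_inj.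
have forall_im (P : pred {set T}) : [forall u : {set T}, P u] = [forall u : {set T}, P (a @: u)].
  apply/forallP/forallP=> Pu u //; by rewrite -(imset_permKV a u).
exists (perm f_inj); last first.
  move=> x xZ; rewrite permE; apply: injective_projections; first by rewrite /= dE.
  apply/ffunP=> u; rewrite -(imset_permKV a u) fE /upd.
  set w := a^-1 @: u; case: ifP => [/andP[wlarge xw]|nw].
    by have [->] := thP w wlarge; rewrite // inE xZ xw.
  have /forallP/(_ (a @: w)) := dvalid x xZ.
  rewrite (large_im _ Ga) dE // mem_a nw => /eqP->.
  by have /forallP/(_ w) := vembed_valid x; rewrite nw => /eqP.
exists a => //; split=> [y|y|y z]; rewrite !permE //.
  rewrite /valid forall_im; apply: eq_forallb => u; rewrite fE mem_a (large_im _ Ga) /upd.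
  case E: (large u && (y.1 \in u)) => //; have /andP[ularge _] := E.
  have [_ <-] := thP u ularge.
  by rewrite !in_slots card_imset //; exact: perm_inj.
rewrite /generic (inj_eq perm_inj) forall_im; congr (_ && _); apply: eq_forallb => u.
rewrite !fE !mem_a (large_im _ Ga) /upd.
by case: and3P => //= -[-> -> ->] /=; rewrite (inj_eq perm_inj).
Qed.

Lemma vaut_extension : extension to good vembed vaut.
Proof.
split.
- move=> a b s t [a' Ga [a1 av ag]] [b' Gb [b1 bv bg]].
  exists (a' * b'); first exact: (extM extT).
  by split=> *; rewrite !permM ?b1 ?a1 ?bv ?bg.
- move=> a s [a' Ga [a1 av ag]]; exists a'^-1; first exact: (extV extT Ga).
  split=> [y|y|y z].
  + by apply: (@perm_inj _ a'); rewrite -a1 !permKV.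
  + by rewrite -av permKV.
  by rewrite -ag !permKV.
- move=> a s x y [a' Ga [a1 _ _]] /(congr1 fst); rewrite a1; exact: (ext_act extT Ga).
- move=> a s Z [a' Ga [a1 _ _]] gZ aZ; apply: (ext_good extT Ga gZ) => x /aZ /(congr1 fst).
  by rewrite a1.
move=> Z s /(ext_extend extT)[a Ga aZ].
have [|||b Gb bZ] := @lift_copy a s Z (fun x => vembed (to x s)) Ga; last by exists b.
- by move=> x /aZ ->.
- by move=> x _; apply: vembed_valid.
- by move=> x y _ _ xy; apply: vembed_generic; rewrite (inj_eq (act_inj _ _)).
Qed.

(** Points in a common translate are generic.  So the projection of [D] is
    injective and its image is not large, by the pigeonhole principle; it
    therefore lies in a translate, to which [D] is lifted by [lift_copy]. *)
Lemma vaut_conformal D : pairwise_in_copies vembed vaut D -> in_copy vembed vaut D.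
Proof.
move=> Dpair.
have Dvalid d : d \in D -> valid d.
  move=> dD; have [b [s [[a _ [_ bv _]] bd]]] := Dpair d d dD dD.
  have [|x ->] := bd d; first by rewrite !inE eqxx.
  by rewrite bv vembed_valid.
have Dgen d d' : d \in D -> d' \in D -> d != d' -> generic d d'.
  move=> dD d'D; have [b [s [[a _ [_ _ bg]] bd]]] := Dpair d d' dD d'D.
  have [|x ->] := bd d; first by rewrite !inE eqxx.
  have [|x' ->] := bd d'; first by rewrite !inE eqxx orbT.
  by rewrite (inj_eq perm_inj) bg => xx'; apply: vembed_generic; apply: contraNneq xx' => ->.
pose w := [set d.1 | d in D].
have injD : {in D &, injective (fun d : vpoint => d.1)}.
  move=> d d' dD d'D /= dd'; apply/eqP; apply: contraT => /(Dgen _ _ dD d'D).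
  by rewrite /generic dd' eqxx.
have [/asboolP[a [s [Ga aw]]]|wlarge] := boolP `[< in_copy i G w >].
  pose d x := odflt (vembed x) [pick d in D | d.1 == a (i x)].
  pose Z := [set x | a (i x) \in w].
  have dP x : x \in Z -> d x \in D /\ (d x).1 = a (i x).
    rewrite inE => /imsetP[y yD ay]; rewrite /d; case: pickP => [z /andP[zD /eqP]//|].
    by move/(_ y); rewrite yD ay eqxx.
  have [|||b Gb bZ] := @lift_copy a s Z d Ga.
  - by move=> x /dP[].
  - by move=> x /dP[/Dvalid].
  - move=> x y /dP[xD dx] /dP[yD dy] xy; apply: Dgen => //; apply: contraNneq xy => dxy.
    by apply/eqP/(ext_inj good_sym extT)/(@perm_inj _ a); rewrite -dx -dy dxy.
  exists b, s; split=> // z zD; have /aw[x zx] : z.1 \in w by apply: imset_f.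
  have xZ : x \in Z by rewrite inE -zx imset_f.
  exists x; rewrite bZ //; have [dD dx] := dP x xZ.
  by apply: injD; rewrite // dx.
have w_gt0 : 0 < #|w|.
  rewrite card_gt0; apply: contraNneq wlarge => ->; apply/asboolP.
  by exists 1, 1; split; [exact: (ext1 good_sym extT) | move=> d; rewrite inE].
have: #|[set (d : vpoint).2 w | d in D]| <= #|slots w|.
  apply: subset_leq_card; apply/subsetP=> v /imsetP[d dD ->].
  have /forallP/(_ w) := Dvalid d dD.
  by rewrite [large w]wlarge imset_f.
rewrite card_in_imset; last first.
  move=> d d' dD d'D /eqP dd'; apply/eqP; apply: contraTT dd' => /(Dgen _ _ dD d'D).
  by case/andP=> _ /forallP/(_ w); rewrite [large w]wlarge !imset_f.
rewrite -(card_in_imset injD) -/w => wle.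
have: #|slots w| <= #|w|.-1.
  rewrite cardE -(size_map val) -[X in _ <= X](size_iota 0).
  apply: uniq_leq_size; first by rewrite map_inj_uniq ?enum_uniq //; exact: val_inj.
  by move=> n /mapP[v]; rewrite mem_enum inE mem_iota => vw ->.
by move/(leq_trans wle); rewrite leqNgt prednK ?leqnn.
Qed.

End Conformal.

(** * Third extension: closures *)

Section Closures.
Local Open Scope group_scope.
Variables (X : finType) (gT : finGroupType) (to : {action gT &-> X}).
Variable good : {set X} -> gT -> bool.
Implicit Types (Y Z V : {set X}) (s : gT) (x y : X).

Record closure_lattice : Prop := ClosureLattice {
  clatT : good setT 1;
  clatI : forall Y Z, good Y 1 -> good Z 1 -> good (Y :&: Z) 1;
  clatU : forall Y Z, good Y 1 -> good Z 1 -> good (Y :|: Z) 1 }.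

Definition cl x : {set X} := \bigcap_(Z : {set X} | good Z 1 && (x \in Z)) Z.

Definition cl_closed (T : finType) (i : X -> T) (G : {perm T} -> gT -> Prop)
    (D : {set T}) : Prop :=
  forall a s x y, G a s -> a (i x) \in D -> y \in cl x -> a (i y) \in D.

(** [cext_agree] combines two facts: the points of the copy that [a] sends back
    into the copy form a closed set, and [s] is good on it. *)
Record conformal_extension (T : finType) (i : X -> T)
    (G : {perm T} -> gT -> Prop) : Prop := ConformalExtension {
  cext_ext : extension to good i G;
  cext_agree : forall a s, G a s -> good [set x | a (i x) == i (to x s)] s;
  cext_conformal : forall D, cl_closed i G D -> pairwise_in_copies i G D ->
    in_copy i G D }.

Hypothesis good_sym : partial_symmetries to good.
Hypothesis good_lat : closure_lattice.

Lemma cl_good x : good (cl x) 1.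
Proof.
apply: (big_ind (fun Z : {set X} => good Z 1)); first exact: clatT.
  exact: (clatI good_lat).
by move=> Z /andP[].
Qed.

Lemma mem_cl x : x \in cl x.
Proof. by apply/bigcapP=> Z /andP[]. Qed.

Lemma cl_min x Z : good Z 1 -> x \in Z -> cl x \subset Z.
Proof. by move=> gZ xZ; apply: bigcap_inf; rewrite gZ. Qed.

Lemma cl_trans x y : y \in cl x -> cl y \subset cl x.
Proof. exact: cl_min (cl_good x). Qed.

(** This is where closure under unions enters: a set is strong as soon as it
    contains the closures of its points. *)
Lemma good1_cl Z : (forall x, x \in Z -> cl x \subset Z) -> good Z 1.
Proof.
move=> clZ; have -> : Z = \bigcup_(x in Z) cl x.
  apply/eqP; rewrite eqEsubset; apply/andP; split; last exact/bigcupsP.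
  by apply/subsetP=> x xZ; apply/bigcupP; exists x; rewrite // mem_cl.
apply: (big_ind (fun Z : {set X} => good Z 1)); first exact: (psym0 good_sym).
  exact: (clatU good_lat).
by move=> x _; apply: cl_good.
Qed.

Lemma cl_im_sub Z s x : good Z s -> x \in Z -> cl (to x s) \subset to^* (cl x) s.
Proof.
move=> gZ xZ; apply: cl_min; last by apply: mem_setact; apply: mem_cl.
have gcl : good (cl x) s.
  exact: (psymS good_sym gZ (cl_min (psym1 good_sym gZ) xZ) (cl_good x)).
exact: (psym_im1 good_sym gcl).
Qed.

Lemma cl_im Z s x : good Z s -> x \in Z -> to^* (cl x) s = cl (to x s).
Proof.
move=> gZ xZ; apply/eqP; rewrite eqEsubset (cl_im_sub gZ) // andbT.
have := cl_im_sub (x := to x s) (psymV good_sym gZ).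
rewrite mem_setact // actK => /(_ isT) sub.
by have := imsetS (to^~ s) sub; rewrite -!setactE actKV.
Qed.

(** Two translates may share a point of [T] without sharing its closure.
    Remembering the translated closure [i @: cl x] with each point prevents
    this: an automorphism that maps [cembed x] into the copy of [X] maps the
    whole closure of [x] into it. *)
Section Build.
Variables (T : finType) (i : X -> T) (G : {perm T} -> gT -> Prop).
Hypothesis extT : extension to good i G.
Hypothesis confT : forall D, pairwise_in_copies i G D -> in_copy i G D.

Definition cpoint := (T * {set T})%type.
Definition cembed x : cpoint := (i x, i @: cl x).
Definition lifts (b : {perm cpoint}) (a : {perm T}) : Prop :=
  forall y : cpoint, b y = (a y.1, a @: y.2).
Definition caut (b : {perm cpoint}) s : Prop := exists2 a, G a s & lifts b a.

Lemma exists_lift (a : {perm T}) : exists b, lifts b a.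
Proof.
pose f (y : cpoint) : cpoint := (a y.1, a @: y.2).
have f_inj : injective f.
  move=> [b c] [b' c'] [/perm_inj <- /(congr1 (fun u : {set T} => a^-1 @: u))].
  by rewrite !imset_permK => ->.
by exists (perm f_inj) => y; rewrite permE.
Qed.

Lemma liftsM b b' a a' : lifts b a -> lifts b' a' -> lifts (b * b') (a * a').
Proof.
move=> ba ba' y; rewrite permM ba ba' permM -imset_comp; congr (_, _).
by apply: eq_imset => x; rewrite permM.
Qed.

Lemma liftsV b a : lifts b a -> lifts b^-1 a^-1.
Proof.
move=> ba y; apply: (@perm_inj _ b); rewrite permKV ba /= permKV.
by rewrite imset_permKV; case: y.
Qed.

Lemma agree_on_cl a s x : G a s -> {in cl x, forall z, exists z', a (i z) = i z'} ->
  {in cl x, forall z, a (i z) = i (to z s)} /\ good (cl x) s.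
Proof.
move=> Ga acl; have agree : {in cl x, forall z, a (i z) = i (to z s)}.
  by move=> z /acl[z' az]; rewrite az (ext_act extT Ga az).
split=> //; exact: (ext_good extT Ga (cl_good x)).
Qed.

Lemma cembed_agree b a s x y : G a s -> lifts b a -> b (cembed x) = cembed y ->
  {in cl x, forall z, a (i z) = i (to z s)} /\ good (cl x) s.
Proof.
move=> Ga ba; rewrite ba => -[axy aclxy]; apply: (agree_on_cl Ga) => z zx.
have : a (i z) \in i @: cl y by rewrite -aclxy !imset_f.
by case/imsetP=> z' _ ->; exists z'.
Qed.

Lemma lift_cembed b a s x : lifts b a -> good (cl x) s ->
  {in cl x, forall z, a (i z) = i (to z s)} -> b (cembed x) = cembed (to x s).
Proof.
move=> ba gx ax; rewrite ba /cembed /= ax ?mem_cl //; congr (_, _).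
rewrite -(cl_im gx (mem_cl x)) setactE -!imset_comp.
by apply: eq_in_imset => z zx /=; apply: ax.
Qed.

Lemma caut_extension : extension to good cembed caut.
Proof.
split.
- move=> b b' s s' [a Ga ba] [a' Ga' ba']; exists (a * a'); first exact: (extM extT).
  exact: liftsM.
- move=> b s [a Ga ba]; exists a^-1; [exact: (extV extT) | exact: liftsV].
- by move=> b s x y [a Ga ba]; rewrite ba => -[/(ext_act extT Ga)].
- move=> b s Z [a Ga ba] gZ bZ; apply: (ext_good extT Ga gZ) => x /bZ.
  by rewrite ba => -[].
move=> Z s gZ; have [a Ga aZ] := ext_extend extT gZ; have [b ba] := exists_lift a.
exists b => [|x xZ]; first by exists a.
have clZ := cl_min (psym1 good_sym gZ) xZ.
apply: (lift_cembed ba); first exact: (psymS good_sym gZ clZ (cl_good x)).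
by move=> z /(subsetP clZ); apply: aZ.
Qed.

Lemma caut_agree b s : caut b s ->
  good [set x | b (cembed x) == cembed (to x s)] s.
Proof.
move=> [a Ga ba]; set V := [set x | _].
have gV : good V 1.
  apply: good1_cl => x; rewrite inE => /eqP /(cembed_agree Ga ba)[ax gx].
  apply/subsetP=> y yx; rewrite inE; apply/eqP/(lift_cembed ba).
    exact: (psymS good_sym gx (cl_trans yx) (cl_good y)).
  by move=> z /(subsetP (cl_trans yx)); apply: ax.
apply: (ext_good extT Ga gV) => x; rewrite inE => /eqP; by rewrite ba => -[].
Qed.

(** The projection of [D] lies in a translate [a] of the old copy.  For a point
    [d] of [D], the closure remembered by [d] also projects into this translate,
    because [D] is closed; hence it agrees with the closure computed in the
    translate, and [d] lies in the corresponding translate of the new copy. *)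
Lemma caut_conformal D : cl_closed cembed caut D ->
  pairwise_in_copies cembed caut D -> in_copy cembed caut D.
Proof.
move=> Dcl Dpair; pose pD := [set (d : cpoint).1 | d in D].
have [|a [s [Ga apD]]] := confT (D := pD).
  move=> _ _ /imsetP[d dD ->] /imsetP[d' d'D ->].
  have [b [s [[a Ga ba] bdd']]] := Dpair d d' dD d'D; exists a, s; split=> // e.
  rewrite !inE => /orP[]/eqP->.
    by have [|x ->] := bdd' d; rewrite ?inE ?eqxx //; exists x; rewrite ba.
  by have [|x ->] := bdd' d'; rewrite ?inE ?eqxx ?orbT //; exists x; rewrite ba.
have [b ba] := exists_lift a; exists b, s; split=> [|d dD]; first by exists a.
have [b' [s' [caut_b' b'd]]] := Dpair d d dD dD; have [a' Ga' ba'] := caut_b'.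
have [|x' dx'] := b'd d; first by rewrite !inE eqxx.
rewrite dx' in dD *; exists (to x' (s' * s^-1)).
apply: (canRL (permKV b)); rewrite -permM.
have G1 := extM extT Ga' (extV extT Ga).
have [z zx'|ax' gx'] := agree_on_cl (x := x') G1.
  have : a' (i z) \in pD.
    by apply/imsetP; exists (b' (cembed z)); [exact: Dcl caut_b' dD zx' | rewrite ba'].
  by case/apD=> z' az'; exists z'; rewrite permM az' permK.
exact: lift_cembed (liftsM ba' (liftsV ba)) gx' ax'.
Qed.

End Build.
End Closures.

Theorem exists_conformal_extension (X : finType) (gT : finGroupType)
    (to : {action gT &-> X}) (good : {set X} -> gT -> bool) :
    partial_symmetries to good -> closure_lattice good ->
  exists (T : finType) (i : X -> T) (G : {perm T} -> gT -> Prop),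
    conformal_extension to good i G.
Proof.
move=> good_sym good_lat; have [T [i [G extT]]] := exists_extension good_sym.
have extT2 := vaut_extension good_sym extT.
have confT2 := vaut_conformal good_sym extT.
exists _, (cembed good (vembed i G)), (caut (vaut i G)); split.
- exact: (caut_extension good_sym good_lat extT2).
- exact: (caut_agree good_sym good_lat extT2).
exact: (caut_conformal good_sym good_lat extT2 confT2).
Qed.

Local Open Scope fset_scope.

(** * Finite structures and smooth classes *)

Section Structures.
Variables (U : choiceType) (L : language).
Implicit Types (A B C : fstruct U L) (S : {fset U}).

(** Equality of structures is extensional, so that restrictions and amalgams can
    be compared by rewriting. *)
Lemma fstruct_eq A B : dom A = dom B ->
  (forall (s : sym L) (t : (ar s).-tuple U), holds A t = holds B t) -> A = B.
Proof.
case: A B => [dA hA pA] [dB hB pB] /= eqd eqh; subst dB.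
have {}eqh : hA = hB.
  by apply: functional_extensionality_dep => s; apply: funext => t; apply: eqh.
by subst hB; rewrite (Prop_irrelevance pA pB).
Qed.

Lemma all_memP (S : {fset U}) n (t : n.-tuple U) :
  reflect (forall k, tnth t k \in S) (all (mem S) t).
Proof. exact: all_tnthP. Qed.

Lemma all_mem_sub S S' n (t : n.-tuple U) :
  S `<=` S' -> all (mem S) t -> all (mem S') t.
Proof. by move=> /fsubsetP SS' /allP tS; apply/allP=> x /tS /SS'. Qed.

Lemma all_memI S S' n (t : n.-tuple U) :
  all (mem (S `&` S')) t = all (mem S) t && all (mem S') t.
Proof. by rewrite -all_predI; apply: eq_all => x; rewrite /= in_fsetI. Qed.

Lemma holds_all A (s : sym L) (t : (ar s).-tuple U) :
  all (mem (dom A)) t && holds A t = holds A t.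
Proof. by case E: (holds A t); rewrite ?andbF // (holds_dom E). Qed.

Lemma restrict_sub A S : substruct (restrict_struct A S) A.
Proof.
split=> [|s t]; first exact: fsubsetIl.
by rewrite all_memI => /andP[_ tS] /=; rewrite tS.
Qed.

Lemma substructE A B : substruct A B -> A = restrict_struct B (dom A).
Proof.
move=> [AB holdsAB]; apply: fstruct_eq => [|s t] /=.
  by apply/esym/fsetIidPr.
rewrite -[LHS]holds_all; case E: (all _ _) => //=; exact: holdsAB.
Qed.

Lemma restrict_restrict A S S' :
  restrict_struct (restrict_struct A S) S' = restrict_struct A (S `&` S').
Proof.
apply: fstruct_eq => [|s t] /=; first by rewrite fsetIA.
by rewrite all_memI andbCA andbA.
Qed.

Lemma restrict_dom A S : dom A `<=` S -> restrict_struct A S = A.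
Proof.
move=> AS; apply: fstruct_eq => [|s t] /=; first exact/fsetIidPl.
case E: (holds A t); rewrite ?andbF // andbT.
exact: all_mem_sub AS (holds_dom E).
Qed.

Lemma dom_restrict A S : S `<=` dom A -> dom (restrict_struct A S) = S.
Proof. by move=> SA; apply/fsetIidPr. Qed.

Lemma restrict_substruct A S S' : S `<=` S' ->
  substruct (restrict_struct A S) (restrict_struct A S').
Proof.
move/fsetIidPl=> SS'; rewrite -SS' fsetIC -restrict_restrict; exact: restrict_sub.
Qed.

Lemma substruct_refl A : substruct A A.
Proof. by split=> //; apply: fsubset_refl. Qed.

Lemma qf_sat_iso f A B V (v : V -> U) (phi : qf L V) : iso f A B ->
  (forall x, v x \in dom A) -> qf_sat A v phi = qf_sat B (f \o v) phi.
Proof.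
move=> [finj _ fholds] vA; elim: phi => //=.
- move=> x y; apply/eqP/eqP=> [->//|]; exact: finj.
- move=> s t; rewrite fholds; last by apply/all_memP=> k; rewrite tnth_map; exact: vA.
  by congr (holds B _); apply: val_inj; rewrite /= -map_comp.
- by move=> p ->.
- by move=> p -> q ->.
by move=> p -> q ->.
Qed.

Lemma usat_iso f A B n (b : n.-tuple U) (phi : uformula L n) : iso f A B ->
  all (mem (dom A)) b -> usat A b phi -> usat B (map_tuple f b) phi.
Proof.
move=> fAB bA sat y yB.
have /fin_all_exists[z zP] k : exists z, z \in dom A /\ f z = tnth y k.
  have /all_memP/(_ k) := yB; have [_ <- _] := fAB.
  by case/imfsetP=> z /= zA ->; exists z.
pose z' := [tuple z k | k < uvars phi].
have zA : all (mem (dom A)) z' by apply/all_memP=> k; rewrite tnth_mktuple; case: (zP k).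
have := sat z' zA; rewrite (qf_sat_iso _ fAB); last first.
  by case=> k /=; [exact/all_memP | exact/(all_memP _ z')].
congr (is_true (qf_sat _ _ _)); apply: funext => -[k|k] /=; rewrite tnth_map // tnth_ord_tuple.
by case: (zP k).
Qed.

End Structures.

Section SmoothClass.
Variables (U : choiceType) (L : language) (K : fclass U L).
Hypothesis K_smooth : smooth K.
Implicit Types (A B C : fstruct U L) (S : {fset U}).

(** [B] satisfies the formulas that say that [A] is strong; they are the same
    for [A'], and an isomorphism transports their truth to [B']. *)
Lemma le_iso f A B A' B' : le_class K A B -> iso f B B' -> iso f A A' ->
  substruct A' B' -> le_class K A' B'.
Proof.
move=> AB fB fA A'B'; have [AK BK] := smooth_mem K_smooth AB.
have A'K := smooth_iso K_smooth AK fA; have B'K := smooth_iso K_smooth BK fB.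
have [Phi [PhiP Phi_iso]] := smooth_formulas K_smooth.
pose a := in_tuple (enum_fset (dom A)).
have aA : enumerates a A by split; [exact: fset_uniq | move=> x].
have [finj fdom _] := fA.
have faA' : enumerates (map_tuple f a) A'.
  split; first by rewrite map_inj_in_uniq ?fset_uniq.
  move=> x; rewrite -fdom; apply/mapP/imfsetP=> -[y yA ->]; by exists y.
have [_ aP] := PhiP _ _ _ AK aA; have [_ a'P] := PhiP _ _ _ A'K faA'.
apply/(a'P _ B'K A'B') => phi /(Phi_iso _ _ _ _ _ AK A'K fA aA) phiA.
apply: (usat_iso fB).
  by apply/allP=> x; rewrite aA.2; apply/fsubsetP; case: (smooth_sub K_smooth AB).
by move: phi phiA; apply/(aP _ BK (smooth_sub K_smooth AB)).
Qed.

Hypothesis K_fAP : fAP K.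

(** Amalgamating [A] with the empty structure over the empty structure gives
    back [A]. *)
Lemma le_refl A : mem_class K A -> le_class K A A.
Proof.
move=> AK; have emptyA := smooth_empty_le K_smooth AK.
have empty := smooth_empty_le K_smooth (smooth_empty K_smooth).
have [|_ + _] := K_fAP emptyA empty; first by rewrite /= fsetI0.
by congr le_class; apply: fstruct_eq => [|s t] /=; rewrite ?fsetU0 ?orbF.
Qed.

Hypothesis K_local : one_local K.

Definition strong A S : Prop := le_class K (restrict_struct A S) A.

Lemma restrict_mem A S : mem_class K A -> mem_class K (restrict_struct A S).
Proof. by move/(one_local_sub K_local); apply; apply: restrict_sub. Qed.

Lemma strong_full A : mem_class K A -> strong A (dom A).
Proof. by move=> AK; rewrite /strong restrict_dom ?fsubset_refl //; apply: le_refl. Qed.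

Lemma restrict_to_restrict A S S' : S `<=` S' ->
  restrict_struct (restrict_struct A S) (dom (restrict_struct A S')) =
  restrict_struct A S.
Proof.
move=> /fsetIidPl SS'; rewrite restrict_restrict /= fsetICA SS' fsetIC.
by rewrite -restrict_restrict [LHS]restrict_dom //= fsubsetIl.
Qed.

(** Universal formulas remain true in substructures; here this is an instance of
    smooth intersections. *)
Lemma strong_restrict A S S' : S `<=` S' -> mem_class K A -> strong A S ->
  le_class K (restrict_struct A S) (restrict_struct A S').
Proof.
move=> SS' AK AS.
have := one_local_inter K_local (restrict_mem S AK) AK (restrict_mem S' AK)
  (restrict_sub A S) (substruct_refl A) (restrict_sub A S') AS.
by rewrite restrict_to_restrict // -(substructE (restrict_sub A S')).
Qed.

Lemma strongI A S S' : mem_class K A -> strong A S -> strong A S' -> strong A (S `&` S').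
Proof.
move=> AK AS AS'; apply: smooth_trans (AS') => //.
have := one_local_inter K_local (restrict_mem S AK) AK (restrict_mem S' AK)
  (restrict_sub A S) (substruct_refl A) (restrict_sub A S') AS.
rewrite -(substructE (restrict_sub A S')) restrict_restrict /= fsetICA fsetIC.
by rewrite -restrict_restrict restrict_dom //= fsubsetIl.
Qed.

Lemma strongU A S S' : S `<=` dom A -> S' `<=` dom A -> mem_class K A ->
  strong A S -> strong A S' -> strong A (S `|` S').
Proof.
move=> SA S'A AK AS AS'.
have := one_local_union K_local (restrict_mem S AK) AK (restrict_mem S' AK)
  (restrict_sub A S) (restrict_sub A S') AS AS'.
by rewrite !dom_restrict.
Qed.

End SmoothClass.

(** * Transport of finite sets into the universe *)

Section Injections.
Variable U : choiceType.
Hypothesis U_infinite : forall S : {fset U}, exists x : U, x \notin S.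

Lemma exists_fresh_seq (S : {fset U}) n :
  exists r : seq U, [/\ size r = n, uniq r & {in r, forall x, x \notin S}].
Proof.
elim: n => [|n [r [szr ur rS]]]; first by exists [::].
have [x] := U_infinite (S `|` [fset y in r]); rewrite !inE negb_or => /andP[xS xr].
exists (x :: r); split=> /=; [by rewrite szr | by rewrite xr | move=> y].
by rewrite inE => /orP[/eqP->|/rS].
Qed.

Lemma exists_injection_extending (S : {fset U}) (T : finType) (i : S -> T) :
  injective i ->
  exists j : T -> U, injective j /\ forall x, j (i x) = val x.
Proof.
move=> i_inj; have [r [szr ur rS]] := exists_fresh_seq S #|T|.
pose j t := if [pick x | i x == t] is Some x then val x
            else tnth (in_tuple r) (cast_ord (esym szr) (enum_rank t)).
have fresh k : tnth (in_tuple r) k \notin S by apply: rS; rewrite mem_tnth.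
exists j; split=> [t t'|x]; rewrite /j; last first.
  by case: pickP => [y /eqP/i_inj->//|/(_ x)]; rewrite eqxx.
case: pickP => [x /eqP <-|_]; case: pickP => [y /eqP <-|_].
- by move/val_inj->.
- by move=> xk; have := fresh (cast_ord (esym szr) (enum_rank t')); rewrite -xk (valP x).
- by move=> xk; have := fresh (cast_ord (esym szr) (enum_rank t)); rewrite xk (valP y).
by move/(elimT (tuple_uniqP (in_tuple r)) ur) /cast_ord_inj /enum_rank_inj.
Qed.

End Injections.

Section Transfer.
Variables (U : choiceType) (X : finType) (v h : X -> U).

Definition transfer u : U := if [pick x | v x == u] is Some x then h x else u.

Lemma transferE : injective v -> forall x, transfer (v x) = h x.
Proof.
by move=> v_inj x; rewrite /transfer; case: pickP => [y /eqP/v_inj->|/(_ x)] //; rewrite eqxx.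
Qed.

Lemma transfer_map n (t : n.-tuple X) : injective v ->
  map_tuple transfer (map_tuple v t) = map_tuple h t.
Proof.
move=> v_inj; apply: eq_from_tnth => k; by rewrite !tnth_map transferE.
Qed.

End Transfer.

Section VertexSets.
Variables (U : choiceType) (X : finType) (v : X -> U).
Implicit Types (Y Z : {set X}).

Definition vset Z : {fset U} := [fset v x | x in Z].

Lemma vsetP u Z : reflect (exists2 x, x \in Z & u = v x) (u \in vset Z).
Proof. by apply: (iffP (imfsetP _ _ _ _)) => -[x xZ ->]; exists x. Qed.

Lemma mem_vset x Z : injective v -> (v x \in vset Z) = (x \in Z).
Proof. by move=> v_inj; rewrite mem_imfset. Qed.

Lemma vset0 : vset set0 = fset0.
Proof. by apply/fsetP=> u; rewrite inE; apply/vsetP=> -[x]; rewrite inE. Qed.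

Lemma vsetI Y Z : injective v -> vset (Y :&: Z) = vset Y `&` vset Z.
Proof.
move=> v_inj; apply/fsetP=> u; rewrite inE; apply/vsetP/andP=> [[x /setIP[xY xZ] ->]|].
  by split; apply/vsetP; exists x.
by move=> [/vsetP[x xY ->] /vsetP[y yZ /v_inj xy]]; exists x; rewrite // inE xY xy.
Qed.

Lemma vsetU Y Z : vset (Y :|: Z) = vset Y `|` vset Z.
Proof.
apply/fsetP=> u; rewrite inE; apply/vsetP/orP=> [[x /setUP[xY|xZ] ->]|].
- by left; apply/vsetP; exists x.
- by right; apply/vsetP; exists x.
by case=> /vsetP[x xZ ->]; exists x; rewrite // inE xZ ?orbT.
Qed.

Variables (L : language) (A : fstruct U L).
Hypothesis domA : dom A = [fset v x | x in X].

Lemma domAP u : u \in dom A <-> exists x, u = v x.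
Proof.
rewrite domA; split=> [/imfsetP[x _ ->]|[x ->]]; first by exists x.
exact: in_imfset.
Qed.

Lemma vset_sub Z : vset Z `<=` dom A.
Proof. by apply/fsubsetP=> _ /vsetP[x _ ->]; apply/domAP; exists x. Qed.

End VertexSets.

Lemma tuple_preimage (U X : Type) (v : X -> U) (P : X -> Prop) n (t : n.-tuple U) :
  (forall k, exists2 x, P x & tnth t k = v x) ->
  exists2 t' : n.-tuple X, forall k, P (tnth t' k) & t = map_tuple v t'.
Proof.
move=> tv; have /fin_all_exists[f fP] k : exists x, P x /\ tnth t k = v x.
  by have [x] := tv k; exists x.
exists [tuple f k | k < n] => [k|].
  by rewrite tnth_mktuple; case: (fP k).
by apply: eq_from_tnth => k; rewrite tnth_map tnth_mktuple; case: (fP k).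
Qed.

(** * Gluing translates of a structure *)

Section Gluing.
Variables (X : finType) (gT : finGroupType) (to : {action gT &-> X}).
Variable good : {set X} -> gT -> bool.
Hypothesis good_sym : partial_symmetries to good.
Hypothesis good_lat : closure_lattice good.
Variables (T : finType) (i : X -> T) (G : {perm T} -> gT -> Prop).
Hypothesis extT : conformal_extension to good i G.
Variables (U : choiceType) (j : T -> U).
Hypothesis j_inj : injective j.
Implicit Types (x y : X) (a b : {perm T}) (s : gT).

Definition copy a x : U := j (a (i x)).

Definition covered : {fset U} :=
  [fset j t | t in [set t : T | `[< exists a s x, G a s /\ t = a (i x) >]]].

Lemma coveredP u : u \in covered <-> exists a s x, G a s /\ u = copy a x.
Proof.
split=> [/imfsetP[t /=]|[a [s [x [Ga ->]]]]].
  by rewrite inE => /asboolP[a [s [x [Ga ->]]]] ->; exists a, s, x.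
by apply: in_imfset; rewrite /= inE; apply/asboolP; exists a, s, x.
Qed.

(** Any two translates meet in the same way as a translate meets the copy itself:
    in the image of a set on which a good map relates them. *)
Lemma transition a b s t : G a s -> G b t ->
  exists2 V, good V (s * t^-1)%g &
    forall x y, copy a x = copy b y <-> x \in V /\ y = to x (s * t^-1)%g.
Proof.
move=> Ga Gb; have ext := cext_ext extT.
have Gab := extM ext Ga (extV ext Gb).
exists [set x | (a * b^-1)%g (i x) == i (to x (s * t^-1)%g)]; first exact: cext_agree extT _ _ Gab.
move=> x y; rewrite inE; split=> [/j_inj axy|[/eqP axy ->]].
  have abx : (a * b^-1)%g (i x) = i y by rewrite permM axy permK.
  by rewrite abx (ext_act ext Gab abx).
by rewrite /copy -axy permM permKV.
Qed.

Lemma copy_inj a : injective (copy a).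
Proof. by move=> x y /j_inj/perm_inj/(ext_inj good_sym (cext_ext extT)). Qed.

(** [u] lies in the closure of [w], computed in some translate; by [below_copy]
    all translates containing [w] give the same answer. *)
Definition below (u w : U) : Prop :=
  exists a s x y, [/\ G a s, w = copy a x, y \in cl good x & u = copy a y].

Definition below_closed (D : {fset U}) : Prop :=
  D `<=` covered /\ forall u w, w \in D -> below u w -> u \in D.

Lemma below_copy a s u x : G a s -> below u (copy a x) ->
  exists2 y, y \in cl good x & u = copy a y.
Proof.
move=> Ga [b [t [x' [y' [Gb /esym wx' yx' ->]]]]].
have [V gV VP] := transition Gb Ga.
have [x'V xE] := (VP x' x).1 wx'.
have sub := subsetP (cl_min (psym1 good_sym gV) x'V) _ yx'.
exists (to y' (t * s^-1)%g); last exact/VP.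
by rewrite xE -(cl_im good_sym good_lat gV x'V) mem_setact.
Qed.

Lemma below_refl u : u \in covered -> below u u.
Proof.
by move/coveredP=> [a [s [x [Ga ->]]]]; exists a, s, x, x; split=> //; apply: mem_cl.
Qed.

Lemma below_trans u w z : below u w -> below w z -> below u z.
Proof.
move=> uw [a [s [x [y [Ga zx yx wy]]]]]; rewrite wy in uw.
have [y' y'y uy'] := below_copy Ga uw; exists a, s, x, y'; split=> //.
exact: (subsetP (cl_trans good_lat yx)) _ y'y.
Qed.

Lemma below_covered u w : below u w -> u \in covered.
Proof. by move=> [a [s [x [y [Ga _ _ ->]]]]]; apply/coveredP; exists a, s, y. Qed.

Lemma below_closedI D E : below_closed D -> below_closed E -> below_closed (D `&` E).
Proof.
move=> [Dcov Dcl] [_ Ecl]; split; first exact: fsubset_trans (fsubsetIl _ _) Dcov.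
move=> u w /fsetIP[wD wE] uw; apply/fsetIP; split; [exact: Dcl uw | exact: Ecl uw].
Qed.

Lemma below_closed_covered : below_closed covered.
Proof. by split=> [|u w _]; [exact: fsubset_refl | exact: below_covered]. Qed.

(** The largest closed subset of a closed set [D] that does not contain [u]. *)
Definition avoid (D : {fset U}) u : {fset U} := [fset w in D | ~~ `[< below u w >]].

Lemma avoidP D u w : reflect (w \in D /\ ~ below u w) (w \in avoid D u).
Proof.
by rewrite !inE /=; apply: (iffP andP) => -[wD] /asboolPn.
Qed.

Lemma below_closed_avoid D u : below_closed D -> below_closed (avoid D u).
Proof.
move=> [Dcov Dcl]; split; first by apply/fsubsetP=> w /avoidP[/(fsubsetP Dcov)].
move=> w z /avoidP[zD uz] wz; apply/avoidP; split; first exact: Dcl wz.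
by move=> uw; apply: uz; apply: below_trans wz.
Qed.

Lemma below_closed_conformal D : below_closed D ->
  (forall u w, u \in D -> w \in D ->
     exists a s x y, [/\ G a s, u = copy a x & w = copy a y]) ->
  exists a s, G a s /\ forall u, u \in D -> exists x, u = copy a x.
Proof.
move=> [Dcov Dcl] Dpair; pose D' := [set t | j t \in D].
have [||a [s [Ga aD]]] := cext_conformal extT (D := D').
- move=> a s x y Ga; rewrite !inE => axD yx; apply: (Dcl) axD _.
  by exists a, s, x, y.
- move=> t t'; rewrite !inE => tD t'D; have [a [s [x [y [Ga tx t'y]]]]] := Dpair _ _ tD t'D.
  exists a, s; split=> // d; rewrite !inE => /orP[]/eqP->; [exists x | exists y]; exact: j_inj.
exists a, s; split=> // u uD; have /coveredP[b [t [x [Gb ux]]]] := fsubsetP Dcov u uD.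
by rewrite ux in uD *; have [|y by_] := aD (b (i x)); [rewrite inE | exists y; rewrite /copy by_].
Qed.

Definition move_by a : U -> U := transfer j (fun t => j (a t)).

Lemma move_byE a t : move_by a (j t) = j (a t).
Proof. exact: transferE. Qed.

Lemma move_by_copy a b x : move_by a (copy b x) = copy (b * a) x.
Proof. by rewrite move_byE /copy permM. Qed.

Lemma move_by_dom a s : G a s -> [fset move_by a u | u in covered] = covered.
Proof.
move=> Ga; have ext := cext_ext extT; apply/fsetP=> u; apply/imfsetP/idP=> /=.
  move=> [_ /coveredP[b [t [x [Gb ->]]]] ->]; rewrite move_by_copy; apply/coveredP.
  by exists (b * a)%g, (t * s)%g, x; split=> //; apply: (extM ext).
move/coveredP=> [b [t [x [Gb ->]]]]; exists (copy (b * a^-1) x).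
  apply/coveredP; exists (b * a^-1)%g, (t * s^-1)%g, x; split=> //.
  exact: (extM ext Gb (extV ext Ga)).
by rewrite move_by_copy mulgKV.
Qed.

Lemma move_by_inj a : {in covered &, injective (move_by a)}.
Proof.
move=> u w /imfsetP[t _ ->] /imfsetP[t' _ ->]; by rewrite !move_byE => /j_inj/perm_inj->.
Qed.

Section GluedStructure.
Variables (L : language) (A : fstruct U L) (v : X -> U).
Hypothesis v_inj : injective v.
Hypothesis jv : forall x, j (i x) = v x.
Hypothesis domA : dom A = [fset v x | x in X].
Hypothesis good_holds : forall Z s, good Z s ->
  forall (r : sym L) (t : (ar r).-tuple X), all (mem Z) t ->
    holds A (map_tuple v t) = holds A (map_tuple (fun x => v (to x s)) t).

Definition glue_holds (r : sym L) (t : (ar r).-tuple U) : bool :=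
  `[< exists a s (t' : (ar r).-tuple X),
      [/\ G a s, holds A (map_tuple v t') & t = map_tuple (copy a) t'] >].

Lemma glue_holds_dom (r : sym L) (t : (ar r).-tuple U) :
  glue_holds t -> all (mem covered) t.
Proof.
move/asboolP=> [a [s [t' [Ga _ ->]]]]; apply/all_memP=> k; rewrite tnth_map.
by apply/coveredP; exists a, s, (tnth t' k).
Qed.

Definition glue : fstruct U L := FStruct glue_holds_dom.

(** Overlapping translates of [A] agree, by [transition] and goodness. *)
Lemma glue_copy a s (r : sym L) (t : (ar r).-tuple X) : G a s ->
  holds glue (map_tuple (copy a) t) = holds A (map_tuple v t).
Proof.
move=> Ga; apply/asboolP/idP=> [[b [s' [t' [Gb At' tt']]]]|At]; last by exists a, s, t.
have [V gV VP] := transition Ga Gb.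
have tV k : tnth t k \in V /\ tnth t' k = to (tnth t k) (s * s'^-1)%g.
  by apply/VP; have := congr1 (fun t => tnth t k) tt'; rewrite !tnth_map.
rewrite (good_holds gV); last by apply/all_tnthP=> k; case: (tV k).
congr (is_true (holds A _)): At'; apply: eq_from_tnth => k; rewrite !tnth_map.
by case: (tV k) => _ ->.
Qed.

Lemma move_by_iso a s : G a s -> iso (move_by a) glue glue.
Proof.
move=> Ga; have ext := cext_ext extT.
have one b t' (r : sym L) (t : (ar r).-tuple U) : G b t' ->
    holds glue t -> holds glue (map_tuple (move_by b) t).
  move=> Gb /asboolP[c [s' [t'' [Gc At ->]]]]; apply/asboolP.
  exists (c * b)%g, (s' * t')%g, t''; split=> //; first exact: (extM ext).
  by apply: eq_from_tnth => k; rewrite !tnth_map move_by_copy.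
split; [exact: move_by_inj | exact: (move_by_dom Ga) |].
move=> r t tcov; apply/idP/idP; first exact: one Ga.
move/(one _ _ _ _ (extV ext Ga)); congr (is_true (holds glue _)).
apply: eq_from_tnth => k; rewrite !tnth_map.
by have /all_memP/(_ k)/imfsetP[w _ ->] := tcov; rewrite !move_byE permK.
Qed.

Lemma copy1 x : copy 1 x = v x.
Proof. by rewrite /copy perm1 jv. Qed.

Lemma domA_covered : dom A `<=` covered.
Proof.
apply/fsubsetP=> u /(domAP domA)[x ->]; apply/coveredP; exists 1%g, 1%g, x.
by rewrite copy1; split=> //; apply: (ext1 good_sym (cext_ext extT)).
Qed.

Lemma glue_sub : substruct A glue.
Proof.
split=> [|r t tA]; first exact: domA_covered.
have [|t' _ ->] := @tuple_preimage _ _ v (fun _ => True) _ t.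
  by move=> k; have /all_memP/(_ k)/(domAP domA)[x ->] := tA; exists x.
rewrite -(glue_copy t' (ext1 good_sym (cext_ext extT))); congr (holds glue _).
by apply: eq_from_tnth => k; rewrite !tnth_map copy1.
Qed.

Lemma below_closed_domA : below_closed (dom A).
Proof.
split=> [|u w /(domAP domA)[x ->]]; first exact: domA_covered.
rewrite -copy1 => /(below_copy (ext1 good_sym (cext_ext extT)))[y _ ->].
by apply/(domAP domA); exists y; rewrite copy1.
Qed.

Section GluedClass.
Variable K : fclass U L.
Hypothesis K_smooth : smooth K.
Hypothesis K_fAP : fAP K.
Hypothesis K_local : one_local K.
Hypothesis AK : mem_class K A.
Hypothesis good1P : forall Z, good Z 1 <-> strong K A (vset v Z).

Lemma copy_trace_strong a s E : G a s -> below_closed E ->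
  strong K A (vset v [set x | copy a x \in E]).
Proof.
move=> Ga [_ Ecl]; apply/good1P; apply: (good1_cl good_sym good_lat) => x; rewrite inE => xE.
apply/subsetP=> y yx; rewrite inE; apply: Ecl xE _; by exists a, s, x, y.
Qed.

Lemma copy_iso a s E : G a s -> E `<=` covered -> (forall u, u \in E -> exists x, u = copy a x) ->
  iso (transfer v (copy a)) (restrict_struct A (vset v [set x | copy a x \in E]))
    (restrict_struct glue E).
Proof.
move=> Ga Ecov Ea; have fE x : transfer v (copy a) (v x) = copy a x by exact: transferE.
split; rewrite ?dom_restrict ?(vset_sub domA) //.
- move=> _ _ /imfsetP[x _ ->] /imfsetP[y _ ->]; by rewrite !fE => /copy_inj->.
- apply/fsetP=> u; apply/imfsetP/idP=> /= [[_ /imfsetP[x /= xE ->] ->]|uE].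
    by rewrite fE; rewrite inE in xE.
  have [x ux] := Ea u uE; exists (v x); last by rewrite fE.
  by rewrite (mem_vset _ _ v_inj) inE -ux.
move=> r t tE; have [|t' t'E tE'] := @tuple_preimage _ _ v (fun x => copy a x \in E) _ t.
  by move=> k; have /all_memP/(_ k)/imfsetP[x /= + ->] := tE; rewrite inE; exists x.
rewrite tE' transfer_map // in tE *; rewrite /= tE /=.
have -> : all (mem E) (map (copy a) t').
  by apply/(all_memP _ (map_tuple (copy a) t'))=> k; rewrite tnth_map.
by rewrite [RHS](glue_copy t' Ga).
Qed.

(** The irreducible case: a closed set inside one translate is isomorphic to a
    strong substructure of [A], and so are its closed subsets. *)
Lemma glue_in_copy a s D : G a s -> below_closed D ->
    (forall u, u \in D -> exists x, u = copy a x) ->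
  mem_class K (restrict_struct glue D) /\
  forall E, E `<=` D -> below_closed E ->
    le_class K (restrict_struct glue E) (restrict_struct glue D).
Proof.
move=> Ga Dcl Da; have isoD := copy_iso Ga Dcl.1 Da.
split; first exact: (smooth_iso K_smooth (restrict_mem K_local _ AK) isoD).
move=> E ED Ecl; have isoE := copy_iso Ga Ecl.1 (fun u uE => Da u (fsubsetP ED u uE)).
apply: (le_iso K_smooth _ isoD isoE); last exact: restrict_substruct.
have EA := copy_trace_strong Ga Ecl.
refine (strong_restrict K_local _ AK EA).
apply/fsubsetP=> _ /imfsetP[x /= xE ->]; rewrite (mem_vset _ _ v_inj) !inE in xE *.
exact: (fsubsetP ED).
Qed.

(** The translate that supports a related tuple, or a point, has [u] or [w] below
    none of its points, as otherwise it would contain both [u] and [w].  So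
    every point and every related tuple of [D] avoids [u] or avoids [w]. *)
Lemma glue_free D u w : below_closed D ->
    ~ (exists a s x y, [/\ G a s, u = copy a x & w = copy a y]) ->
  free_amalgam (restrict_struct glue (avoid D u)) (restrict_struct glue (avoid D w)) =
  restrict_struct glue D.
Proof.
move=> Dcl nuw; have sub z : avoid D z `<=` D by apply/fsubsetP=> z' /avoidP[].
have cov z : avoid D z `<=` covered by exact: fsubset_trans (sub z) Dcl.1.
have either a s x y : G a s -> below u (copy a x) -> below w (copy a y) -> False.
  move=> Ga /(below_copy Ga)[x' _ ux'] /(below_copy Ga)[y' _ wy']; apply: nuw.
  by exists a, s, x', y'.
apply: fstruct_eq => [|r t] /=.
  rewrite !(fsetIidPr _) // ?Dcl.1 //; apply/fsetP=> z.
  apply/fsetUP/idP=> [[]/(fsubsetP (sub _))//|zD].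
  have /coveredP[a [s [x [Ga zx]]]] := fsubsetP Dcl.1 z zD.
  have [uz|nuz] := pselect (below u z); last by left; apply/avoidP.
  right; apply/avoidP; split=> // wz; apply: (either a s x x); by rewrite -?zx.
rewrite -andb_orl; case E: (glue_holds t); rewrite ?andbF // !andbT.
have /asboolP[a [s [t' [Ga _ tt']]]] := E.
apply/orP/idP=> [[]|tD]; try exact: all_mem_sub.
have [[k ku]|nu] := pselect (exists k, below u (tnth t k)); [right | left];
  apply/all_memP=> k'; apply/avoidP; (split; first exact/all_memP).
  move=> kw; apply: (either a s (tnth t' k) (tnth t' k') Ga).
    by rewrite tt' tnth_map in ku.
  by rewrite tt' tnth_map in kw.
by move=> kw; apply: nu; exists k'.
Qed.

(** By induction on [#|D|].  Two points in no common translate split [D] into a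
    free amalgam of two smaller closed sets.  Both are strong in [D] by free
    amalgamation, and a closed subset [E] of [D] is the union of its traces on
    them, each strong in [D] by the induction hypothesis and transitivity;
    1-locality makes the union strong. *)
Lemma glue_closed D : below_closed D ->
  mem_class K (restrict_struct glue D) /\
  forall E, E `<=` D -> below_closed E ->
    le_class K (restrict_struct glue E) (restrict_struct glue D).
Proof.
have [n] := ubnP #|`D|; elim: n D => // n IH D /ltnSE Dn Dcl.
have [Dpair|/existsNP[u /existsNP[w]]] := pselect (forall u w, u \in D -> w \in D ->
    exists a s x y, [/\ G a s, u = copy a x & w = copy a y]).
  have [a [s [Ga aD]]] := below_closed_conformal Dcl Dpair.
  exact: glue_in_copy Ga Dcl aD.
move=> /not_implyP[uD /not_implyP[wD nuw]].
have avoid_sub z : avoid D z `<=` D by apply/fsubsetP=> z' /avoidP[].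
have avoid_lt z : z \in D -> #|`avoid D z| < n.
  move=> zD; apply: leq_trans Dn; apply: fproper_ltn_card.
  rewrite fproperE avoid_sub /=; apply/fsubsetPn; exists z => //.
  apply/avoidP=> -[_]; apply; apply: below_refl; exact: (fsubsetP Dcl.1).
have IHz z : z \in D -> _ := fun zD => IH _ (avoid_lt z zD) (below_closed_avoid z Dcl).
have [DuK Du] := IHz u uD; have [DwK Dw] := IHz w wD.
have Duw := below_closedI (below_closed_avoid u Dcl) (below_closed_avoid w Dcl).
have := K_fAP (Du _ (fsubsetIl _ _) Duw) (Dw _ (fsubsetIr _ _) Duw).
rewrite (glue_free Dcl nuw) /= => -[|DK DuD DwD].
  by rewrite fsetIACA fsetIid.
split=> // E ED Ecl.
have EDz z : z \in D ->
    le_class K (restrict_struct glue (avoid D z)) (restrict_struct glue D) ->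
    strong K (restrict_struct glue D) (E `&` avoid D z).
  move=> zD; rewrite /strong restrict_restrict.
  have -> : D `&` (E `&` avoid D z) = E `&` avoid D z.
    by apply/fsetIidPr; apply: fsubset_trans (fsubsetIr _ _) (avoid_sub z).
  apply: (smooth_trans K_smooth); apply: (IHz z zD).2; first exact: fsubsetIr.
  exact: below_closedI Ecl (below_closed_avoid z Dcl).
have subD z : E `&` avoid D z `<=` dom (restrict_struct glue D).
  rewrite dom_restrict ?Dcl.1 //; exact: fsubset_trans (fsubsetIl _ _) ED.
have domD : avoid D u `|` avoid D w = D.
  have := congr1 (@dom _ _) (glue_free Dcl nuw); rewrite /=.
  by rewrite !(fsetIidPr _) ?Dcl.1 //; apply: fsubset_trans (avoid_sub _) Dcl.1.
have := strongU K_local (subD u) (subD w) DK (EDz u uD DuD) (EDz w wD DwD).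
by rewrite /strong restrict_restrict -fsetIUr domD (fsetIidPl ED) (fsetIidPr ED).
Qed.

Lemma glue_mem : mem_class K glue.
Proof.
have [+ _] := glue_closed below_closed_covered.
by rewrite restrict_dom ?fsubset_refl.
Qed.

Lemma glue_le : le_class K A glue.
Proof.
have [_ /(_ _ domA_covered below_closed_domA)] := glue_closed below_closed_covered.
by rewrite (restrict_dom (A := glue) (S := covered)) ?fsubset_refl // -(substructE glue_sub).
Qed.

End GluedClass.
End GluedStructure.
End Gluing.

(** * Tuple equivalence relations and colours *)

Section TupleEquiv.
Variables (U : choiceType) (n : nat).

Lemma cat_tupleP (t : (n + n).-tuple U) : exists a b : n.-tuple U, t = cat_tuple a b.
Proof.
have ta : size (take n t) == n by rewrite size_takel // size_tuple leq_addr.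
have tb : size (drop n t) == n by rewrite size_drop size_tuple addnK.
by exists (Tuple ta), (Tuple tb); apply: val_inj; rewrite /= cat_take_drop.
Qed.

Lemma map_cat_tuple (V : Type) (f : V -> U) (a b : n.-tuple V) :
  map_tuple f (cat_tuple a b) = cat_tuple (map_tuple f a) (map_tuple f b).
Proof. by apply: val_inj; rewrite /= map_cat. Qed.

Lemma Erel_perm (A : fstruct U (lang_E n)) (a b a' b' : n.-tuple U) :
  tuple_equiv A -> perm_eq a' a -> perm_eq b' b -> Erel A a b -> Erel A a' b'.
Proof.
move=> eqA /tuple_permP[p a'E] /tuple_permP[q b'E] ab.
have -> : b' = permute_tuple q b by apply: val_inj.
apply: (teq_perm eqA); apply: (teq_sym eqA).
have -> : a' = permute_tuple p a by apply: val_inj.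
by apply: (teq_perm eqA); apply: (teq_sym eqA).
Qed.

End TupleEquiv.

Section Colours.
Variables (U : choiceType) (X : finType) (v : X -> U).
Hypothesis v_inj : injective v.
Variable A : forall n, fstruct U (lang_E n.+1).
Hypothesis domA : forall n, dom (A n) = [fset v x | x in X].
Hypothesis A_equiv : forall n, tuple_equiv (A n).
Implicit Types (S : {set X}).

(** All the relations [E_n] at once, as a relation between nonempty sets of
    points.  Sets of different sizes are never related. *)
Definition eqv S S' : Prop := exists n (a b : n.+1.-tuple X),
  [/\ S =i a, S' =i b & Erel (A n) (map_tuple v a) (map_tuple v b)].

Definition colour S : {set {set X}} := [set S' | `[< eqv S S' >]].

Lemma same_enum S n n' (a : n.+1.-tuple X) (a' : n'.+1.-tuple X) :
  uniq a -> uniq a' -> S =i a -> S =i a' -> n = n' /\ perm_eq a a'.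
Proof.
move=> ua ua' Sa Sa'; have aa' : perm_eq a a'.
  by apply: uniq_perm => // x; rewrite -Sa Sa'.
by split=> //; have := perm_size aa'; rewrite !size_tuple => -[].
Qed.

Lemma Erel_uniq n (a b : n.+1.-tuple X) :
  Erel (A n) (map_tuple v a) (map_tuple v b) -> uniq a /\ uniq b.
Proof. by move/(teq_uniq (A_equiv n)); rewrite /= !map_inj_uniq. Qed.

Lemma eqv_tuples n (a b : n.+1.-tuple X) S S' : uniq a -> uniq b -> S =i a -> S' =i b ->
  eqv S S' <-> Erel (A n) (map_tuple v a) (map_tuple v b).
Proof.
move=> ua ub Sa S'b; split=> [[n' [a' [b' [Sa' S'b' ab']]]]|]; last by exists n, a, b.
have [ua' ub'] := Erel_uniq ab'.
have [nn' aa'] := same_enum ua ua' Sa Sa'; subst n'.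
have [_ bb'] := same_enum ub ub' S'b S'b'.
by apply: (Erel_perm (A_equiv n)) ab'; apply: perm_map.
Qed.

Lemma eqv_refl S : S != set0 -> eqv S S.
Proof.
rewrite -card_gt0 cardE => S0; have sz : size (enum S) == (size (enum S)).-1.+1.
  by rewrite prednK.
pose a := Tuple sz; have Sa : S =i a by move=> x; rewrite mem_enum.
apply/(eqv_tuples (a := a) (b := a)) => //; try exact: enum_uniq.
apply: (teq_refl (A_equiv _)); last by rewrite map_inj_uniq ?enum_uniq.
by apply/all_memP=> k; rewrite tnth_map domA; apply: in_imfset.
Qed.

Lemma eqv_sym S S' : eqv S S' -> eqv S' S.
Proof.
by move=> [n [a [b [Sa S'b ab]]]]; exists n, b, a; split=> //; apply: (teq_sym (A_equiv n)).
Qed.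

Lemma eqv_trans S S' S'' : eqv S S' -> eqv S' S'' -> eqv S S''.
Proof.
move=> [n [a [b [Sa S'b ab]]]] [n' [b' [c [S'b' S''c bc]]]].
have [ua ub] := Erel_uniq ab; have [ub' uc] := Erel_uniq bc.
have [nn' bb'] := same_enum ub ub' S'b S'b'; subst n'.
exists n, a, c; split=> //; apply: (teq_trans (A_equiv n) ab).
by apply: (Erel_perm (A_equiv n)) bc; rewrite ?perm_map.
Qed.

Lemma colourP S S' : S != set0 -> S' != set0 -> colour S = colour S' <-> eqv S S'.
Proof.
move=> S0 S'0; split=> [SS'|SS'].
  have : S' \in colour S by rewrite SS' inE; apply/asboolP/eqv_refl.
  by rewrite inE => /asboolP.
apply/setP=> S''; rewrite !inE; apply/asboolP/asboolP; apply: eqv_trans => //.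
exact: eqv_sym.
Qed.

Variables (gT : finGroupType) (to : {action gT &-> X}).
Variable good : {set X} -> gT -> bool.
Hypothesis good_sym : partial_symmetries to good.
Hypothesis good_lat : closure_lattice good.
Variables (T : finType) (i : X -> T) (G : {perm T} -> gT -> Prop).
Hypothesis extT : conformal_extension to good i G.
Variable (j : T -> U).
Hypothesis j_inj : injective j.
Hypothesis jv : forall x, j (i x) = v x.
Variable toC : {action gT &-> {set {set X}}}.
Hypothesis good_colour : forall Z s, good Z s ->
  forall S, S \subset Z -> S != set0 -> toC (colour S) s = colour (to^* S s)%g.

Local Notation copy := (copy i j).
Local Notation covered := (covered i G j).
Local Notation move_by := (move_by j).

Definition traces a (r : seq U) S : Prop := forall u, u \in r <-> exists2 x, x \in S & u = copy a x.

(** A tuple of [B] that lies in a translate inherits the colour of its points in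
    [A], moved along with the translate; by [has_colour_copy] this colour does
    not depend on the translate.  Other tuples have no colour. *)
Definition has_colour (r : seq U) (c : {set {set X}}) : Prop :=
  exists a s S, [/\ G a s, traces a r S & c = toC (colour S) s].

Lemma has_colour_eqi r r' c : r =i r' -> has_colour r c -> has_colour r' c.
Proof. by move=> rr' [a [s [S [Ga rS ->]]]]; exists a, s, S; split=> // u; rewrite -rr'. Qed.

Lemma has_colour_copy a s r S c : G a s -> traces a r S -> S != set0 ->
  has_colour r c <-> c = toC (colour S) s.
Proof.
move=> Ga rS S0; split=> [[b [t [S' [Gb rS' ->]]]]|->]; last by exists a, s, S.
have [V gV VP] := transition extT j_inj Ga Gb.
have S'E : S' = (to^* S (s * t^-1)%g)%g.
  apply/setP=> y; rewrite setactE; apply/idP/imsetP=> [yS'|[x xS ->]].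
    have /rS[x xS xy] : copy b y \in r by apply/rS'; exists y.
    by exists x => //; case: ((VP x y).1 (esym xy)).
  have /rS'[z zS' xz] : copy a x \in r by apply/rS; exists x.
  by have [_ <-] := (VP x z).1 xz.
have SV : S \subset V.
  apply/subsetP=> x xS; have /rS'[y _ xy] : copy a x \in r by apply/rS; exists x.
  by case: ((VP x y).1 xy).
by rewrite S'E -(good_colour gV SV S0) -actM mulgKV.
Qed.

Lemma has_colour_move a s r c : G a s -> has_colour r c ->
  has_colour (map (move_by a) r) (toC c s).
Proof.
move=> Ga [b [t [S [Gb rS ->]]]]; exists (b * a)%g, (t * s)%g, S; split.
- exact: extM (cext_ext extT) _ _ _ _ Gb Ga.
- move=> u; split=> [/mapP[w /rS[x xS ->] ->]|[x xS ->]].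
    by exists x => //; rewrite move_by_copy.
  by rewrite -move_by_copy //; apply: map_f; apply/rS; exists x.
by rewrite actM.
Qed.

Lemma move_byK a : {in covered, cancel (move_by a) (move_by a^-1%g)}.
Proof. by move=> u /imfsetP[t _ ->]; rewrite !move_byE // permK. Qed.

Lemma has_colour_moveE a s r c : G a s -> all (mem covered) r ->
  has_colour (map (move_by a) r) c <-> has_colour r (toC c s^-1%g).
Proof.
move=> Ga rcov; split=> [|/(has_colour_move Ga)]; last by rewrite actKV.
move/(has_colour_move (extV (cext_ext extT) Ga)); rewrite -map_comp map_id_in //.
by move=> u ur /=; apply: move_byK; apply: (allP rcov).
Qed.

Section Arity.
Variable n : nat.

(** Tuples are equivalent when they have the same colours; in particular the
    tuples that lie in no translate form a single class. *)
Definition Eglue_holds (q : sym (lang_E n.+1)) (t : (ar q).-tuple U) : bool :=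
  [&& all (mem covered) t, uniq (take n.+1 t), uniq (drop n.+1 t) &
    `[< forall c, has_colour (take n.+1 t) c <-> has_colour (drop n.+1 t) c >]].

Lemma Eglue_holds_dom q (t : (ar q).-tuple U) : Eglue_holds t -> all (mem covered) t.
Proof. by case/and4P. Qed.

Definition Eglue : fstruct U (lang_E n.+1) := FStruct Eglue_holds_dom.

Lemma EglueP (a b : n.+1.-tuple U) : Erel Eglue a b <->
  [/\ all (mem covered) a, all (mem covered) b, uniq a, uniq b &
      forall c, has_colour a c <-> has_colour b c].
Proof.
rewrite /Erel /= /Eglue_holds /= all_cat take_size_cat ?drop_size_cat ?size_tuple //.
split=> [/and4P[/andP[-> ->] -> -> /asboolP] //|[-> -> -> -> ?]].
exact/asboolP.
Qed.

Lemma Eglue_equiv : tuple_equiv Eglue.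
Proof.
split.
- by move=> a b /EglueP[].
- by move=> a acov ua; apply/EglueP.
- by move=> a b /EglueP[acov bcov ua ub ab]; apply/EglueP; split=> // c; split=> /ab.
- move=> a b c /EglueP[acov bcov ua ub ab] /EglueP[_ ccov _ uc bc]; apply/EglueP.
  by split=> // d; split=> [/ab/bc|/bc/ab].
move=> a b s /EglueP[acov bcov ua ub ab]; apply/EglueP.
have bb : perm_eq (permute_tuple s b) b by apply/tuple_permP; exists s.
have mem_bb := perm_mem bb; split=> //; rewrite ?(perm_all _ bb) ?(perm_uniq bb) //.
by move=> c; split=> [/ab|bc]; [|apply/ab; move: bc]; apply: has_colour_eqi.
Qed.

Lemma Eglue_sub : substruct (A n) Eglue.
Proof.
have G1 := ext1 good_sym (cext_ext extT).
split=> [|[] t tA]; first by apply: (domA_covered good_sym extT jv).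
have [a [b tE]] := cat_tupleP t; subst t.
move: tA; rewrite all_cat => /andP[aA bA].
have pre (d : n.+1.-tuple U) : all (mem (dom (A n))) d -> exists d', d = map_tuple v d'.
  move=> dA; have [|d' _ ->] := @tuple_preimage _ _ v (fun _ => True) _ d; last by exists d'.
  by move=> k; have /all_memP/(_ k) := dA; rewrite domA => /imfsetP[x _ ->]; exists x.
have [[a' aE] [b' bE]] := (pre a aA, pre b bA); subst a b.
have cov (d : n.+1.-tuple X) : all (mem covered) (map_tuple v d).
  apply/all_memP=> k; rewrite tnth_map; apply/coveredP; exists 1%g, 1%g, (tnth d k).
  by rewrite (copy1 jv).
have tr (d : n.+1.-tuple X) : traces 1 (map_tuple v d) [set x in d].
  move=> u; split=> [/mapP[x xd ->]|[x]]; first by exists x; rewrite ?inE ?(copy1 jv).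
  by rewrite inE => xd ->; rewrite (copy1 jv); apply: map_f.
have ne (d : n.+1.-tuple X) : [set x in d] != set0.
  by apply/set0Pn; exists (tnth d ord0); rewrite inE mem_tnth.
have hc (d : n.+1.-tuple X) c : has_colour (map_tuple v d) c <-> c = colour [set x in d].
  by rewrite (has_colour_copy _ G1 (tr d) (ne d)) act1.
have mE (d : n.+1.-tuple X) : [set x in d] =i d by move=> x; rewrite inE.
apply/idP/idP=> [ab|/EglueP[_ _ + + ab]].
  have [ua ub] := Erel_uniq ab; apply/EglueP; split=> //; rewrite ?map_inj_uniq //.
  move=> c; rewrite !hc; suff -> : colour [set x in a'] = colour [set x in b'] by [].
  by apply/colourP=> //; apply/(eqv_tuples ua ub).
rewrite !map_inj_uniq // => ua ub; apply/(eqv_tuples ua ub (mE a') (mE b')).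
by apply/colourP=> //; apply/hc/ab/hc.
Qed.

Lemma Eglue_iso a s : G a s -> iso (move_by a) Eglue Eglue.
Proof.
move=> Ga; have ext := cext_ext extT.
split; [exact: move_by_inj | exact: (move_by_dom extT j_inj Ga) |].
case=> t; have [b [c tE]] := cat_tupleP t; subst t.
rewrite all_cat => /andP[bcov ccov]; rewrite map_cat_tuple.
have cov (d : n.+1.-tuple U) : all (mem covered) d -> all (mem covered) (map_tuple (move_by a) d).
  move=> dcov; apply/all_memP=> k; rewrite tnth_map -(move_by_dom extT j_inj Ga).
  by apply: in_imfset; have /all_memP := dcov.
have un (d : n.+1.-tuple U) : all (mem covered) d -> uniq (map_tuple (move_by a) d) = uniq d.
  move=> dcov; rewrite map_inj_in_uniq // => u w /(allP dcov) ucov /(allP dcov).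
  exact: move_by_inj.
apply/idP/idP=> /EglueP[bcov' ccov' ub uc bc]; apply/EglueP.
  rewrite !un // !cov //; split=> // e.
  by rewrite !(has_colour_moveE _ Ga).
rewrite !un // in ub uc; split=> // e.
by have := bc (toC e s); rewrite !(has_colour_moveE _ Ga) // actK.
Qed.

End Arity.
End Colours.

(** * Merging languages *)

Section MergeStructures.
Variables (U : choiceType) (I : countType) (L : I -> language).

Variables (S : {fset U}) (B : forall i, fstruct U (L i)).
Hypothesis domB : forall i, dom (B i) = S.

Definition merge_holds (s : sym (merge_lang L)) (t : (ar s).-tuple U) : bool :=
  @holds U (L (tag s)) (B (tag s)) (tagged s) t.

Lemma merge_holds_dom s (t : (ar s).-tuple U) : merge_holds t -> all (mem S) t.
Proof. by move/holds_dom; rewrite domB. Qed.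

Definition merge_struct : fstruct U (merge_lang L) := FStruct merge_holds_dom.

Lemma reduct_merge i : reduct i merge_struct = B i.
Proof. by apply: fstruct_eq; rewrite /= ?domB. Qed.

End MergeStructures.

Lemma merge_iso (U : choiceType) (I : countType) (L : I -> language) f
    (A B : fstruct U (merge_lang L)) : inhabited I ->
  (forall i, iso f (reduct i A) (reduct i B)) -> iso f A B.
Proof.
move=> [i0] fi; split; [by case: (fi i0) | by case: (fi i0) |].
by move=> [i s] t tA; have [_ _ /(_ s t tA)] := fi i.
Qed.

(** * Partial isomorphisms twisted by the colours *)

Section ProductActions.
Variables X C : finType.
Let gT := ({perm X} * {perm C})%type.

Definition pact1 (x : X) (s : gT) : X := s.1 x.
Definition pact2 (c : C) (s : gT) : C := s.2 c.

Lemma pact1_is_action : is_action [set: gT] pact1.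
Proof.
split=> [s x y|x s t _ _]; [exact: perm_inj | by rewrite /pact1 permM].
Qed.

Lemma pact2_is_action : is_action [set: gT] pact2.
Proof.
split=> [s x y|x s t _ _]; [exact: perm_inj | by rewrite /pact2 permM].
Qed.
Canonical pact1_action := Action pact1_is_action.
Canonical pact2_action := Action pact2_is_action.
End ProductActions.

Lemma dom_val (U : choiceType) (L : language) (A : fstruct U L) :
  dom A = [fset val x | x in (dom A : finType)].
Proof.
apply/fsetP=> u; apply/idP/imfsetP=> [uA|[x _ ->]]; last exact: valP.
by exists [` uA].
Qed.

Section Assembly.
Local Open Scope group_scope.
Local Open Scope fset_scope.
Variables (U : choiceType) (L : language) (K : fclass U L).
Hypotheses (K_smooth : smooth K) (K_local : one_local K) (K_fAP : fAP K).
Variable A : fstruct U L.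
Hypothesis AK : mem_class K A.
Variables (X : finType) (v : X -> U).
Hypothesis v_inj : injective v.
Hypothesis domA : dom A = [fset v x | x in X].
Variables (C : finType) (colour : {set X} -> C).
Let gT : finGroupType := ({perm X} * {perm C})%type.
Implicit Types (Z : {set X}) (s : gT).

Definition strong_piso Z s : bool :=
  `[< [/\ strong K A (vset v Z), strong K A (vset v (s.1 @: Z)),
      forall (r : sym L) (t : (ar r).-tuple X), all (mem Z) t ->
        holds A (map_tuple v t) = holds A (map_tuple (fun x => v (s.1 x)) t) &
      forall S : {set X}, S \subset Z -> S != set0 -> s.2 (colour S) = colour (s.1 @: S)] >].

Lemma strong0 : strong K A fset0.
Proof.
have eA := smooth_empty_le K_smooth AK.
by have := substructE (smooth_sub K_smooth eA); rewrite /strong /= => <-.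
Qed.

Lemma strong_piso1 Z : strong_piso Z 1 <-> strong K A (vset v Z).
Proof.
have imid (S : {set X}) : (1 : {perm X}) @: S = S.
  by rewrite (eq_imset (g := id)) ?imset_id // => x; rewrite perm1.
split=> [/asboolP[]//|ZA]; apply/asboolP; split=> //=; rewrite ?imid //.
  by move=> r t _; congr (holds A _); apply: eq_from_tnth => k; rewrite !tnth_map perm1.
by move=> S _ _; rewrite imid perm1.
Qed.

Lemma vset_iso Z s :
    (forall (r : sym L) (t : (ar r).-tuple X), all (mem Z) t ->
       holds A (map_tuple v t) = holds A (map_tuple (fun x => v (s.1 x)) t)) ->
  iso (transfer v (fun x => v (s.1 x))) (restrict_struct A (vset v Z))
    (restrict_struct A (vset v (s.1 @: Z))).
Proof.
move=> hs; have fE x := transferE (fun x => v (s.1 x)) v_inj x.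
split; rewrite ?dom_restrict ?(vset_sub domA) //.
- by move=> _ _ /vsetP[x _ ->] /vsetP[y _ ->]; rewrite !fE => /v_inj/perm_inj->.
- apply/fsetP=> u; apply/imfsetP/vsetP=> /= [[_ /vsetP[x xZ ->] ->]|[_ /imsetP[x xZ ->] ->]].
    by exists (s.1 x); rewrite ?fE ?imset_f.
  by exists (v x); rewrite ?fE //; apply/vsetP; exists x.
move=> r t tZ; have [|t' t'Z tE] := @tuple_preimage _ _ v (fun x => x \in Z) _ t.
  by move=> k; have /all_memP/(_ k)/vsetP[x xZ ->] := tZ; exists x.
rewrite tE (transfer_map _ _ v_inj) in tZ *; rewrite /= tZ /= hs; last exact/all_tnthP.
suff -> : all (mem (vset v (s.1 @: Z))) (map (fun x => v (s.1 x)) t') by [].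
apply/(all_memP _ (map_tuple (fun x => v (s.1 x)) t'))=> k; rewrite tnth_map.
by apply/vsetP; exists (s.1 (tnth t' k)); rewrite ?imset_f.
Qed.

Lemma strong_piso_symmetries : partial_symmetries (pact1_action X C) strong_piso.
Proof.
split.
- move=> s; apply/asboolP; rewrite imset0 vset0; split; try exact: strong0.
    move=> r t /all_tnthP t0; congr (holds A _); apply: eq_from_tnth => k.
    by have := t0 k; rewrite /= inE.
  by move=> S; rewrite subset0 => /eqP->; rewrite eqxx.
- move=> Z s /asboolP[ZA sZA hs cs]; apply/asboolP; rewrite setactE.
  split=> //; first by rewrite imset_permK.
    move=> r t tZ; pose t' := map_tuple s^-1.1 t.
    have -> : map_tuple v t = map_tuple (fun x => v (s.1 x)) t'.
      by apply: eq_from_tnth => k; rewrite !tnth_map permKV.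
    have -> : map_tuple (fun x => v (s^-1.1 x)) t = map_tuple v t'.
      by apply: eq_from_tnth => k; rewrite !tnth_map.
    rewrite hs //; apply/all_tnthP=> k; rewrite tnth_map.
    by have /all_tnthP/(_ k)/imsetP[x xZ ->] := tZ; rewrite permK.
  move=> S SZ S0; rewrite -{1}(imset_permKV s.1 S) -cs ?permK //.
    by rewrite -(imset_permK s.1 Z) imsetS.
  by rewrite imset_eq0.
- move=> Z s t /asboolP[ZA sZA hs cs] /asboolP[_ tA ht ct]; apply/asboolP.
  have stE (S : {set X}) : (s * t).1 @: S = t.1 @: (s.1 @: S).
    by rewrite -imset_comp; apply: eq_imset => x; rewrite /= permM.
  split=> //; first by rewrite stE.
    move=> r q qZ; rewrite hs //; pose q' := map_tuple s.1 q.
    have -> : map_tuple (fun x => v (s.1 x)) q = map_tuple v q'.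
      by apply: eq_from_tnth => k; rewrite !tnth_map.
    have -> : map_tuple (fun x => v ((s * t).1 x)) q = map_tuple (fun x => v (t.1 x)) q'.
      by apply: eq_from_tnth => k; rewrite !tnth_map permM.
    apply: ht; apply/all_tnthP=> k; rewrite tnth_map; apply: imset_f.
    by apply: (allP qZ); apply: mem_tnth.
  by move=> S SZ S0; rewrite permM cs // ct ?imset_eq0 ?stE //; apply: imsetS.
move=> V Z s gV ZV /strong_piso1 ZA; have /asboolP[VA sVA hs cs] := gV; apply/asboolP.
have hsZ r (t : (ar r).-tuple X) : all (mem Z) t ->
    holds A (map_tuple v t) = holds A (map_tuple (fun x => v (s.1 x)) t).
  move=> tZ; apply: hs; apply/allP=> x xt; apply: (subsetP ZV); exact: (allP tZ).
split=> //.
  apply: (smooth_trans K_smooth) sVA; have isoV := vset_iso hs; have isoZ := vset_iso hsZ.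
  have ZVs : vset v Z `<=` vset v V.
    by apply/fsubsetP=> u /vsetP[x xZ ->]; apply/vsetP; exists x => //; apply: (subsetP ZV).
  have sZVs : vset v (s.1 @: Z) `<=` vset v (s.1 @: V).
    apply/fsubsetP=> u /vsetP[x xZ ->]; apply/vsetP; exists x => //.
    exact: (subsetP (imsetS _ ZV)).
  apply: (le_iso K_smooth _ isoV isoZ (restrict_substruct A sZVs)).
  exact: (strong_restrict K_local ZVs AK ZA).
by move=> S SZ; apply: cs; apply: subset_trans ZV.
Qed.

Lemma strong_piso_lattice : closure_lattice strong_piso.
Proof.
split.
- apply/strong_piso1; have -> : vset v setT = dom A; last exact: strong_full.
  by rewrite domA; apply/fsetP=> u; apply/vsetP/imfsetP=> -[x _ ->]; exists x; rewrite ?inE.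
- move=> Y Z /strong_piso1 YA /strong_piso1 ZA; apply/strong_piso1; rewrite vsetI //.
  exact: strongI.
move=> Y Z /strong_piso1 YA /strong_piso1 ZA; apply/strong_piso1; rewrite vsetU.
by apply: strongU => //; apply: (vset_sub domA).
Qed.

End Assembly.

(** * Extending partial automorphisms of the merge *)

Section PartialAutomorphisms.
Variables (U : choiceType) (L2 : language) (K2 : fclass U L2).
Let K0 := merge_pair (class_Eomega U) K2.
Variable A : fstruct U (merge_lang (lang2 lang_Eomega L2)).
Hypothesis AK : mem_class K0 A.

Definition Epart n : fstruct U (lang_E n.+1) :=
  @reduct U nat (fun n => lang_E n.+1) n (reduct true A).
Definition Kpart : fstruct U L2 := @reduct U bool (lang2 lang_Eomega L2) false A.
Let X : finType := dom A.
Let v : X -> U := val.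
Definition tuple_colour : {set X} -> {set {set X}} := colour v Epart.

Lemma Epart_equiv n : tuple_equiv (Epart n).
Proof. exact: (AK true n). Qed.

Lemma Kpart_mem : mem_class K2 Kpart.
Proof. exact: (AK false). Qed.

Lemma Epart_dom n : dom (Epart n) = [fset v x | x in X].
Proof. exact: (dom_val A). Qed.

(** The partial map on points extends to a permutation [p], and since it
    preserves every [E_n] it induces a partial injection on colours, which
    extends to a permutation [q]. *)
Lemma partial_aut_piso f P Q : partial_aut f A P Q -> le_class K0 P A -> le_class K0 Q A ->
    smooth K2 ->
  exists s : {perm X} * {perm {set {set X}}},
    strong_piso K2 Kpart v tuple_colour [set x : X | v x \in dom P] s /\
    forall x : X, v x \in dom P -> v (s.1 x) = f (v x).
Proof.
move=> [[PA PAh] [QA QAh] [finj fdom fh]] leP leQ K2_smooth.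
set Z := [set x : X | v x \in dom P].
have fA (x : X) : x \in Z -> f (v x) \in dom Q.
  by rewrite inE -fdom => xP; apply: in_imfset.
pose k (x : X) : X := insubd x (f (v x)).
have kE x : x \in Z -> v (k x) = f (v x).
  by move=> xZ; rewrite /v insubdK //; apply: (fsubsetP QA); apply: fA.
have k_inj : {in Z &, injective k}.
  move=> x y xZ yZ /(congr1 v); rewrite !kE // => /finj; rewrite !inE in xZ yZ.
  by move=> /(_ xZ yZ) /val_inj.
have [||p [pE _]] := @extend_to_perm X X setT Z id k.
- by move=> x y xZ yZ; rewrite (inj_in_eq k_inj).
- by move=> x _; rewrite !inE.
have pv x : x \in Z -> v (p x) = f (v x) by move=> xZ; rewrite pE // kE.
have holdsE (r : sym (merge_lang (lang2 lang_Eomega L2))) (t : (ar r).-tuple X) :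
    all (mem Z) t -> holds A (map_tuple v t) = holds A (map_tuple (fun x => v (p x)) t).
  move=> /all_tnthP tZ.
  have tP : all (mem (dom P)) (map_tuple v t).
    by apply/all_memP=> l; rewrite tnth_map; have := tZ l; rewrite /= inE.
  rewrite -PAh // fh //.
  have -> : map_tuple f (map_tuple v t) = map_tuple (fun x => v (p x)) t.
    by apply: eq_from_tnth => l; rewrite !tnth_map pv //; apply: tZ.
  by apply: QAh; apply/all_memP=> l; rewrite tnth_map pv ?fA //; apply: tZ.
have eqvE (S S' : {set X}) : S \subset Z -> S' \subset Z ->
    eqv v Epart S S' <-> eqv v Epart (p @: S) (p @: S').
  move=> SZ S'Z; have holdsE' n (a b : n.+1.-tuple X) : S =i a -> S' =i b ->
      Erel (Epart n) (map_tuple v a) (map_tuple v b) =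
      Erel (Epart n) (map_tuple v (map_tuple p a)) (map_tuple v (map_tuple p b)).
    move=> Sa S'b; rewrite /Erel -!map_cat_tuple.
    rewrite [LHS](holdsE (existT (fun b => sym (lang2 lang_Eomega L2 b)) true (existT _ n tt))).
      by congr (holds (Epart n) _); apply: eq_from_tnth => l; rewrite !tnth_map.
    rewrite /= all_cat; apply/andP; split; apply/allP=> x xab.
      by apply: (subsetP SZ); rewrite Sa.
    by apply: (subsetP S'Z); rewrite S'b.
  have imP (V V' : {set X}) n (a : n.-tuple X) : V =i a -> V' = p @: V -> V' =i map_tuple p a.
    move=> Va -> x; apply/imsetP/mapP=> -[y yV ->]; exists y => //; by rewrite ?Va // -Va.
  split=> [[n [a [b [Sa S'b ab]]]]|[n [a [b [Sa S'b ab]]]]].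
    exists n, (map_tuple p a), (map_tuple p b); split; try exact: imP.
    by rewrite -holdsE'.
  pose a' := map_tuple p^-1%g a; pose b' := map_tuple p^-1%g b.
  have pre (V : {set X}) (c : n.+1.-tuple X) : p @: V =i c -> V =i map_tuple p^-1%g c.
    move=> Vc x; apply/idP/mapP=> [xV|[y]]; last first.
      by rewrite -Vc => /imsetP[z zV ->] ->; rewrite permK.
    by exists (p x); rewrite ?permK // -Vc imset_f.
  have pK (c : n.+1.-tuple X) : map_tuple p (map_tuple p^-1%g c) = c.
    by apply: eq_from_tnth => l; rewrite !tnth_map permKV.
  exists n, a', b'; split; try exact: pre.
  by rewrite holdsE' ?pK //; apply: pre.
have colE (S S' : {set X}) : S != set0 -> S' != set0 ->
    tuple_colour S = tuple_colour S' <-> eqv v Epart S S'.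
  exact: (colourP (v := v) val_inj Epart_dom Epart_equiv).
have [||q [qE _]] := @extend_to_perm _ _ setT [set S : {set X} | (S \subset Z) && (S != set0)]
    tuple_colour (fun S => tuple_colour (p @: S)).
- move=> S S'; rewrite !inE => /andP[SZ S0] /andP[S'Z S'0].
  have pS0 : p @: S != set0 by rewrite imset_eq0.
  have pS'0 : p @: S' != set0 by rewrite imset_eq0.
  apply/eqP/eqP=> [/(colE _ _ S0 S'0)/(eqvE _ _ SZ S'Z)|/(colE _ _ pS0 pS'0)/(eqvE _ _ SZ S'Z)].
    by move/(colE _ _ pS0 pS'0).
  by move/(colE _ _ S0 S'0).
- by move=> S _; rewrite !inE.
exists (p, q); split=> [|x xP]; last by apply: pv; rewrite inE.
have strongE (R : fstruct U (merge_lang (lang2 lang_Eomega L2))) : le_class K0 R A ->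
    strong K2 Kpart (dom R).
  move=> leR; have leR2 : le_class K2 (@reduct U bool (lang2 lang_Eomega L2) false R) Kpart.
    exact: (leR false).
  by have := substructE (smooth_sub K2_smooth leR2); rewrite /strong /= => <-.
apply/asboolP; split=> /=.
- have -> : vset v Z = dom P; last exact: strongE.
  apply/fsetP=> u; apply/imfsetP/idP=> [[x /= + ->]|uP]; first by rewrite inE.
  by exists [` fsubsetP PA u uP]; rewrite //= inE.
- have -> : vset v (p @: Z) = dom Q; last exact: strongE.
  apply/fsetP=> u; apply/imfsetP/idP=> [[_ /= /imsetP[x xZ ->] ->]|].
    by rewrite pv // fA.
  rewrite -fdom => /imfsetP[w /= wP ->]; have wA := fsubsetP PA w wP.
  have wZ : [` wA] \in Z by rewrite inE.
  exists (p [` wA]); first exact: imset_f.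
  by rewrite [RHS]pv.
- by move=> r t tZ; apply: (holdsE (existT (fun b => sym (lang2 lang_Eomega L2 b)) false r)).
by move=> S SZ S0; apply: qE; rewrite inE SZ.
Qed.

End PartialAutomorphisms.

Theorem theorem3p29 (U : choiceType)
    (U_infinite : forall S : {fset U}, exists x : U, x \notin S)
    (L2 : language) (K2 : fclass U L2)
    (K2_smooth : smooth K2) (K2_local : one_local K2) (K2_fAP : fAP K2) :
  EPPA (merge_pair (class_Eomega U) K2).
Proof.
move=> A n f P Q AK fPQ.
pose X : finType := dom A.
pose v : X -> U := val.
pose A2 := Kpart A; have A2K : mem_class K2 A2 := Kpart_mem AK.
pose col := tuple_colour (A := A).
have domAv : dom A2 = [fset v x | x in X] := dom_val A.
have good_sym := strong_piso_symmetries K2_smooth K2_local A2K val_inj domAv col.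
have good_lat := strong_piso_lattice K2_smooth K2_local K2_fAP A2K val_inj domAv col.
have [T [i [G extT]]] := exists_conformal_extension good_sym good_lat.
have i_inj := ext_inj good_sym (cext_ext extT).
have [j [j_inj jv]] := exists_injection_extending U_infinite i_inj.
have /fin_all_exists[a aP] k : exists a : {perm T}, exists2 s, G a s &
    forall x : X, v x \in dom (P k) -> move_by j a (v x) = f k (v x).
  have [pa leP leQ] := fPQ k; have [s [gs sf]] := partial_aut_piso AK pa leP leQ K2_smooth.
  have [a Ga aZ] := ext_extend (cext_ext extT) gs.
  exists a, s => // x xP; rewrite -sf //; have -> : v x = j (i x) by rewrite jv.
  by rewrite move_byE // aZ ?inE //; apply: jv.
have good_holds Z s : strong_piso K2 A2 v col Z s -> forall (r : sym L2) (t : (ar r).-tuple X),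
    all (mem Z) t -> holds A2 (map_tuple v t) =
      holds A2 (map_tuple (fun x => v (pact1_action X _ x s)) t).
  by move=> /asboolP[_ _ hs _].
have good_col Z s : strong_piso K2 A2 v col Z s -> forall S : {set X}, S \subset Z -> S != set0 ->
    pact2_action X _ (col S) s = col (setact (pact1_action X _) S s).
  by move=> /asboolP[_ _ _ hc].
pose BE := merge_struct (B := fun m => Eglue v (Epart A) i G j (pact2_action X _) m)
  (S := covered i G j) (fun m => erefl).
pose B2 : fstruct U L2 := glue i G j A2 v.
pose Bb b : fstruct U (lang2 lang_Eomega L2 b) :=
  if b return fstruct U (lang2 lang_Eomega L2 b) then BE else B2.
have domBb b : dom (Bb b) = covered i G j by case: b.
pose B := merge_struct (I := bool) domBb.
have BbE b : reduct b B = Bb b := reduct_merge domBb b.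
have glueK : mem_class K2 B2.
  exact: (glue_mem good_sym good_lat extT j_inj val_inj domAv good_holds K2_smooth K2_fAP
    K2_local A2K (strong_piso1 K2 A2 v col)).
have glueLe : le_class K2 A2 B2.
  exact: (glue_le good_sym good_lat extT j_inj val_inj jv domAv good_holds K2_smooth K2_fAP
    K2_local A2K (strong_piso1 K2 A2 v col)).
have Eequiv m : tuple_equiv (Eglue v (Epart A) i G j (pact2_action X _) m).
  exact: Eglue_equiv.
have BEm m : @reduct U nat (fun n => lang_E n.+1) m (@reduct U bool (lang2 lang_Eomega L2) true B) =
    Eglue v (Epart A) i G j (pact2_action X _) m.
  rewrite BbE; exact: (reduct_merge (L := fun n => lang_E n.+1)
    (B := fun m => Eglue v (Epart A) i G j (pact2_action X _) m) (fun m => erefl) m).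
have B2E : @reduct U bool (lang2 lang_Eomega L2) false B = B2 by rewrite BbE.
exists B, (fun k => move_by j (a k)); split.
- case; last by rewrite /= B2E.
  by move=> m; rewrite /= BEm.
- case; last by rewrite /= B2E.
  move=> m; rewrite /= BEm; split=> //; first exact: (Epart_equiv AK).
  exact: (Eglue_sub val_inj (Epart_dom A) (Epart_equiv AK) good_sym extT j_inj jv good_col).
move=> k; have [s Ga aP'] := aP k; split; last first.
  move=> u uP; have [[[PA _] _ _] _ _] := fPQ k.
  by have uA := fsubsetP PA u uP; apply: (aP' [` uA]).
apply: merge_iso => [|[]]; first exact: (inhabits true).
  apply: (merge_iso (I := nat)) => [|m]; first exact: (inhabits 0).
  rewrite BEm.
  exact: (Eglue_iso _ _ extT j_inj _ _ Ga).
rewrite B2E.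
exact: (move_by_iso extT j_inj _ _ Ga).
Qed.
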